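(* For every expander $(G_i)$ there is a positive constant $c>0$ with $g(G_i)\ge c\,|G_i|$ for all $i$.
   Context: For a graph $G$, $|G|$ is the number of vertices, and $V(G)$, $E(G)$ are the sets of vertices and edges. The genus $g(G)$ is the minimal genus of an orientable surface into which $G$ can be embedded. The Cheeger constant of a finite graph $G$ is $h(G)=\min |\partial A|/|A|$ over all $A\subset V(G)$ with $0<|A|\le |V(G)|/2$, where $\partial A\subset E(G)$ is the set of edges separating $A$ from its complement $V(G)\setminus A$. An expander is a sequence $(G_i)$ of finite graphs with uniformly bounded valence such that $|G_i|\to\infty$ but $\liminf_{i\to\infty}h(G_i)>0$.
   Formalization: The bound g(G_i) ≥ c|G_i| is proved for all sufficiently large i rather than for all i, since an expander may begin with planar graphs (e.g. G_0 = K_4, of genus 0), for which the bound fails for every c > 0. *)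

(* Defs.v *)
From HB Require Import structures.
From mathcomp Require Import all_boot all_order all_algebra all_fingroup.
From mathcomp Require Import all_classical all_reals all_analysis.

Set Implicit Arguments.
Unset Strict Implicit.
Unset Printing Implicit Defensive.

Import Order.TTheory GRing.Theory Num.Theory.
Import numFieldNormedType.Exports.

Local Open Scope classical_set_scope.
Local Open Scope ring_scope.

(* Finite graphs; loops and multiple edges are allowed.  The direction of an
   edge given by gsrc and gtgt is an arbitrary labelling of its two ends. *)
Record graph := Graph {
  gvertex : finType;
  gedge : finType;
  gsrc : gedge -> gvertex;
  gtgt : gedge -> gvertex }.

Definition nb_vertices (G : graph) : nat := #|gvertex G|.

(* A loop counts twice. *)
Definition valence (G : graph) (v : gvertex G) : nat :=
  (#|[set e | gsrc e == v]%SET| + #|[set e | gtgt e == v]%SET|)%N.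

Definition edge_boundary (G : graph) (A : {set gvertex G}) : {set gedge G} :=
  [set e | (gsrc e \in A) != (gtgt e \in A)]%SET.

(* The minimum over the empty family, i.e. for graphs with at most one vertex,
   is +oo. *)
Definition cheeger (R : realType) (G : graph) : \bar R :=
  \big[Order.min/+oo%E]_(A : {set gvertex G} |
      (0 < #|A|)%N && (2 * #|A| <= nb_vertices G)%N)
    (#|edge_boundary A|%:R / #|A|%:R : R)%:E.

Definition expander (R : realType) (G : nat -> graph) : Prop :=
  [/\ exists d : nat, forall i (v : gvertex (G i)), (valence v <= d)%N,
      nb_vertices (G i) @[i --> \oo] --> \oo
    & (0 < limn_einf (fun i => cheeger R (G i)))%E].

Definition homeomorphic (T U : topologicalType) (A : set T) (B : set U) : Prop :=
  exists (f : T -> U) (g : U -> T),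
    [/\ {within A, continuous f} /\ {within B, continuous g},
        forall x, A x -> B (f x) /\ g (f x) = x
      & forall y, B y -> A (g y) /\ f (g y) = y].

Definition closed_surface (R : realType) (S : topologicalType) : Prop :=
  [/\ compact [set: S], connected [set: S], hausdorff_space S
    & forall x : S, exists U : set S,
        [/\ open U, U x & homeomorphic U [set: 'rV[R]_2]]].

Section Triangulation.
Variables (m : nat) (F : {set {set 'I_m}}).

Definition edges : {set {set 'I_m}} :=
  [set e : {set 'I_m} | (#|e| == 2%N) && [exists t in F, e \subset t]]%SET.

Definition link (v : 'I_m) : rel 'I_m :=
  fun w w' => ([set v; w; w']%SET \in F).

Definition adjacent : rel 'I_m := fun v w => [set v; w]%SET \in edges.

(* F is the set of triangles of a simplicial complex with vertex set 'I_m
   which is a connected combinatorial surface without boundary. *)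
Definition surface_complex : Prop :=
  [/\ (0 < m)%N /\ (forall v : 'I_m, exists2 t, t \in F & v \in t),
      forall t, t \in F -> #|t| = 3%N,
      forall e, e \in edges -> #|[set t in F | e \subset t]%SET| = 2%N,
      forall v w w', adjacent v w -> adjacent v w' -> connect (link v) w w'
    & forall v w, connect adjacent v w].

(* o t restricts to a 3-cycle of the triangle t, i.e. it is an orientation of t
   inducing the directions v -> o t v on the sides of t; coherence means that
   two triangles induce opposite directions on a common side. *)
Definition coherent_orientation (o : {set 'I_m} -> {perm 'I_m}) : Prop :=
  (forall t v, t \in F -> v \in t -> o t v \in t /\ o t v <> v) /\
  (forall t t' v, t \in F -> t' \in F -> v \in t -> v \in t' ->
     o t v = o t' v -> t = t').

Definition euler_char : int := m%:Z - #|edges|%:Z + #|F|%:Z.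

(* The geometric realization, in barycentric coordinates. *)
Definition realization (R : realType) : set 'rV[R]_m :=
  [set x | [/\ forall v, 0 <= x ord0 v, \sum_v x ord0 v = 1
             & exists2 t, t \in F & forall v, v \notin t -> x ord0 v = 0]].

End Triangulation.

Arguments realization {m} F R.

Definition orientable_of_genus (R : realType) (S : topologicalType) (g : nat) :
    Prop :=
  exists (m : nat) (F : {set {set 'I_m}}),
    [/\ surface_complex F,
        homeomorphic [set: S] (realization F R),
        exists o, coherent_orientation F o
      & euler_char F = 2 - 2 * g%:Z].

(* Vertices go to distinct points p v and edges to arcs gamma e over [0, 1]
   (closed curves for loops) that meet only at common ends.  For Hausdorff S
   this is the same as a topological embedding of the geometric graph. *)
Definition embeds (R : realType) (G : graph) (S : topologicalType) : Prop :=
  exists (p : gvertex G -> S) (gamma : gedge G -> R -> S),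
    [/\ injective p,
        forall e, {within `[0, 1], continuous (gamma e)},
        forall e, gamma e 0 = p (gsrc e) /\ gamma e 1 = p (gtgt e),
        forall e (s : R) v, 0 < s < 1 -> gamma e s <> p v
      & forall e e' (s s' : R), 0 < s < 1 -> 0 < s' < 1 ->
          gamma e s = gamma e' s' -> e = e' /\ s = s'].

(* An infimum of natural numbers, hence a minimum: every finite graph embeds
   in some closed orientable surface. *)
Definition genus (R : realType) (G : graph) : \bar R :=
  ereal_inf [set (g%:R : R)%:E | g in [set g : nat |
    exists S : topologicalType,
      [/\ closed_surface R S, orientable_of_genus R S g & embeds R G S]]].

(* Main.v *)
Require Import Defs.
From HB Require Import structures.
From mathcomp Require Import all_boot all_order all_algebra all_fingroup.
From mathcomp Require Import zify ring lra.

(* Cut the closed surface into cells and take a spanning tree of the vertices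
   and a spanning tree of the dual graph that avoids it.  By Euler's formula 2g
   edges remain.  The boundary of a subtree of the dual tree is a cycle mod 2,
   so it lies on the paths of the first tree from its root to the ends of these
   2g edges and of one further edge; off these paths the two sides of the cut
   are not adjacent.  A centroid of the dual tree gives a balanced cut.

   For an arbitrarily wild topological embedding, cut so finely that the sets
   S v of vertices close to the half-edges at v meet only for adjacent v.  The
   S v are connected, hence an uncut S v lies on one side, and only the number
   of sets S v that the root paths hit matters.  In an expander with N vertices,
   a connected set of about eps N vertices reaches all but eps N vertices in a
   number of steps that does not depend on N; a spanning tree following this
   growth makes every root path hit a bounded number of S v, apart from about
   eps N common ones.  So about eps N + O(g) vertices separate the graph in a
   balanced way, whereas expansion requires a fixed proportion of N. *)

Set Implicit Arguments.
Unset Strict Implicit.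
Unset Printing Implicit Defensive.

(** * Rooted trees *)

(** The faces of a wild embedding need not be cells, and its arcs need not follow the edges of any
    subdivision. So Euler's formula is applied to an auxiliary square grid. The number of its cells
    is not bounded in terms of the graph, hence a cut may be measured only by the regions that it
    meets. Two features keep the estimate linear. Each growth step adds an independent set of new
    vertices, so distinct regions of one such layer are disjoint and a root path keeps to one region
    per layer. The faces are squares, so the dual tree has at most 4 children per node and the
    centroid loses only a factor 5: if the cuts meet at most H regions, then |V| <= 5 (K + 1) H + 8
    (d + 1). The seed and the unreached vertices contribute about (d + 2) |V| / M to H; the choice M
    = 10 (K + 1) (d + 2) turns this into |V| / 2, which is absorbed on the left. What remains is
    linear in g + 1. *)

Lemma card_bigcup_le (I T : finType) (A : {pred I}) (B : I -> {set T}) :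
  #|\bigcup_(i in A) B i| <= \sum_(i in A) #|B i|.
Proof.
elim/big_rec2: _ => [|i n X _ leX]; first by rewrite cards0.
by apply: leq_trans (leq_card_setU _ _) _; rewrite leq_add2l.
Qed.

Section RootedTree.
Variables (T : finType) (p : T -> T) (rk : T -> nat) (r : T).

(** The rank certifies that iterating the parent map ends at the root; it need not be the depth, so
    lexicographic ranks can be used too. *)
Definition rooted_tree : Prop :=
  p r = r /\ forall x, x != r -> rk (p x) < rk x.

Definition descendants (x : T) : {set T} := [set z | fconnect p z x].

Lemma descendants_refl x : x \in descendants x.
Proof. by rewrite inE connect0. Qed.

Lemma fconnect_parent x z : fconnect p z x -> z != x -> fconnect p (p z) x.
Proof.
move=> /connectP[[|a s] /= ps ->]; first by rewrite eqxx.
by case/andP: ps => /eqP -> ps _; apply/connectP; exists s.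
Qed.

Lemma descendants_parent x z : p z \in descendants x -> z \in descendants x.
Proof. by rewrite !inE; apply: connect_trans (fconnect1 p z). Qed.

(** The only tree edge that leaves the subtree of [x] is the stem from [x] to its parent. *)
Lemma descendants_cut x z :
  (z \in descendants x) != (p z \in descendants x) -> z = x.
Proof.
have [zx|zx] := boolP (z \in descendants x); last first.
  by have [/descendants_parent|//] := boolP (p z \in _); rewrite (negPf zx).
apply: contraNeq => nzx; move: zx.
by rewrite !inE => /fconnect_parent; apply.
Qed.

Hypothesis treep : rooted_tree.

Lemma rank_fconnect x z : fconnect p z x -> rk x <= rk z.
Proof.
move=> /connectP[s]; elim: s z => [|a s IHs] z /=; first by move=> _ ->.
case/andP=> /eqP <- ps lx.
have [zr|zr] := eqVneq z r.
  by have := IHs _ ps lx; rewrite zr treep.1.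
by apply: leq_trans (IHs _ ps lx) (ltnW (treep.2 _ zr)).
Qed.

Lemma parent_notin_descendants x : x != r -> p x \notin descendants x.
Proof.
move=> xr; rewrite inE; apply/negP=> /rank_fconnect.
by rewrite leqNgt treep.2.
Qed.

Lemma descendants_root x : x \in descendants r.
Proof.
rewrite inE; elim: (rk x).+1 {-2}x (ltnSn (rk x)) => // k IHk y ltk.
have [->|yr] := eqVneq y r; first exact: connect0.
apply: connect_trans (fconnect1 p y) (IHk _ _).
by apply: leq_trans (treep.2 _ yr) _.
Qed.

Lemma descendants_children x z : z \in descendants x -> z != x ->
  exists c, [/\ p c = x, c != x, c != r & z \in descendants c].
Proof.
rewrite inE => /connectP[s]; elim: s z => [|a s IHs] z /=.
  by move=> _ -> /eqP.
case/andP=> /eqP pz ps lx nzx; have [ax|nax] := eqVneq a x.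
  exists z; rewrite pz ax descendants_refl nzx; split=> //.
  apply: contraNneq nzx => zr; rewrite -ax -pz zr treep.1; exact/eqP.
have [c [pc ncx ncr ac]] := IHs _ ps lx nax.
by exists c; split=> //; apply: descendants_parent; rewrite pz.
Qed.

(* Among the vertices whose subtree is heavy, one of maximal rank has only
   light children. *)
Lemma tree_centroid (V : finType) (phi : V -> T) (D w theta : nat) :
    (forall x, #|[set c | (c != r) && (p c == x)]| <= D) ->
    (forall x, #|[set v | phi v == x]| <= w) ->
    (forall x, #|[set v | phi v \in descendants x]| <= theta \/
               #|[set v | phi v \notin descendants x]| <= theta) ->
  #|V| <= D.+1 * theta + w.
Proof.
move=> degD wgt cut.
pose below x := [set v | phi v \in descendants x].
(* If the root is light, the whole of [V] is; otherwise the root is a heavy candidate, which makes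
   the maximum below meaningful. *)
have [small|heavy_r] := leqP #|below r| theta.
  have <- : #|below r| = #|V|.
    by apply: eq_card => v; rewrite !inE [fconnect _ _ _](_ : _ = true) //;
       have := descendants_root (phi v); rewrite inE.
  by apply: leq_trans small _; rewrite mulSn -addnA leq_addr.
pose x := [arg max_(x > r | theta < #|below x|) rk x].
have [heavy_x max_x] : theta < #|below x| /\
    forall y, theta < #|below y| -> rk y <= rk x.
  by rewrite /x; case: arg_maxnP.
have light c : c != r -> p c = x -> #|below c| <= theta.
  move=> cr pc; rewrite leqNgt; apply/negP=> /max_x.
  by rewrite leqNgt -pc treep.2.
pose ch := [set c | (c != r) && (p c == x)].
have sub : below x \subset [set v | phi v == x] :|: \bigcup_(c in ch) below c.
  apply/subsetP=> v; rewrite !inE => vx;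
  have [//|nvx] := eqVneq (phi v) x; apply/bigcupP.
  have := @descendants_children x (phi v); rewrite inE => /(_ vx nvx).
  by case=> c [pc _ cr vc]; exists c; rewrite inE ?pc ?cr ?eqxx.
have := subset_leq_card sub; rewrite cardsU => le1.
have le2 : #|\bigcup_(c in ch) below c| <= D * theta.
  apply: (leq_trans (card_bigcup_le _ _)).
  apply: (@leq_trans (\sum_(c in ch) theta)).
    by apply: leq_sum => c; rewrite inE => /andP[cr /eqP pc]; apply: light.
  by rewrite sum_nat_const leq_mul2r degD orbT.
have le3 : #|~: below x| <= theta.
  have -> : ~: below x = [set v | phi v \notin descendants x].
    by apply/setP=> v; rewrite !inE.
  by case: (cut x) => //; rewrite leqNgt heavy_x.
by have := cardsC (below x); have := wgt x; lia.
Qed.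
End RootedTree.

(** * Distance to a set, and layered spanning trees *)

Section Distance.
Variables (T : finType) (e : rel T) (R : pred T).

Definition reaches (x : T) (k : nat) : bool :=
  [exists s : k.-tuple T, path e x s && R (last x s)].

(** Searching below [#|T|] suffices because paths can be shortened to duplicate-free ones; the value
    [#|T|] means that [R] is out of reach. *)
Definition distance (x : T) : nat := find (reaches x) (iota 0 #|T|).

Lemma distance_reaches x : (exists2 y, R y & connect e x y) ->
  distance x < #|T| /\ reaches x (distance x).
Proof.
case=> y Ry /connectP[s0 ps0 ly]; case/shortenP: ps0 ly => s ps us _ ly.
have szs : size s < #|T|.
  by have := max_card (mem (x :: s)); rewrite (card_uniqP us).
have hasr : has (reaches x) (iota 0 #|T|).
  apply/hasP; exists (size s); first by rewrite mem_iota.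
  by apply/existsP; exists (in_tuple s); rewrite ps -ly.
have := nth_find 0 hasr; rewrite -/(distance x).
by have := hasr; rewrite has_find size_iota => ltd; rewrite nth_iota.
Qed.

Lemma distance_step x : (exists2 y, R y & connect e x y) -> ~~ R x ->
  exists y, [/\ e x y, exists2 z, R z & connect e y z & distance y < distance x].
Proof.
move=> xR nRx; have [ltd] := distance_reaches xR.
case dx: (distance x) ltd => [|k] ltd /existsP[s /andP[]].
  by rewrite tuple0 /= (negPf nRx).
case/tupleP: s => y s /= /andP[exy ps] Ry; exists y; split=> //.
  by exists (last y s) => //; apply/connectP; exists s.
rewrite ltnS leqNgt; apply/negP=> ltk.
have := before_find 0 ltk; rewrite nth_iota; last exact: ltnW.
by move/negbT/negP; apply; apply/existsP; exists s; rewrite ps.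
Qed.
End Distance.

(* The rank puts the layer first and the distance, inside the cell, to the
   lower layers second. *)
Lemma layered_tree (W : finType) (adj : rel W) (lev : W -> nat) (r : W)
    (cell : W -> {set W}) :
  (forall x, x != r -> exists2 y, lev y < lev x &
     connect [rel a b | [&& a \in cell x, b \in cell x & adj a b]] x y) ->
  (forall x y, x != r -> y \in cell x ->
     lev y < lev x \/ lev y = lev x /\ cell y = cell x) ->
  exists p rk, rooted_tree p rk r /\
    forall x, x != r -> [/\ adj x (p x), p x \in cell x &
      lev (p x) < lev x \/ lev (p x) = lev x /\ cell (p x) = cell x].
Proof.
move=> reach same.
(* It depends on [x] only through [lev x] and [cell x], so by [same] the distances of two points of
   one layer and cell are comparable. *)
pose dist x := distance
  [rel a b | [&& a \in cell x, b \in cell x & adj a b]]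
  (fun y => lev y < lev x) x.
have ltd x : x != r -> dist x < #|W|.
  by move=> xr; apply: (distance_reaches _).1; apply: reach.
(* As [dist x < #|W|], this is the lexicographic order of layer and distance; the successor leaves 0
   to the root. *)
pose rk x := if x == r then 0 else (lev x * #|W| + dist x).+1.
have step x : x != r -> exists y,
   [/\ adj x y, y \in cell x, lev y < lev x \/ lev y = lev x /\ cell y = cell x
     & rk y < rk x].
  move=> xr; have := distance_step (reach x xr).
  rewrite ltnn => /(_ isT)[y [/= /and3P[_ yx axy] _ lt_dist]]; exists y.
  have yl := same _ _ xr yx; split=> //.
  rewrite /rk (negPf xr); have [//|yr] := eqVneq; rewrite ltnS.
  case: yl => [lt_lev|[eq_lev eq_cell]].
    rewrite (@leq_trans ((lev y).+1 * #|W|)) //.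
      by rewrite mulSn addnC ltn_add2r ltd.
    by rewrite (leq_trans _ (leq_addr _ _)) // leq_mul2r lt_lev orbT.
  by rewrite eq_lev ltn_add2l /dist eq_lev eq_cell.
pose good x y := (adj x y) && (y \in cell x) &&
  ((lev y < lev x) || (lev y == lev x) && (cell y == cell x)) && (rk y < rk x).
have goodP x : x != r -> exists y, good x y.
  case/step=> y [axy yx yl lt]; exists y; rewrite /good axy yx lt !andbT /=.
  by apply/orP; case: yl => [|[-> ->]]; [left | right; rewrite !eqxx].
pose p x := if x == r then r else odflt x [pick y | good x y].
have pP x : x != r -> good x (p x).
  move=> xr; rewrite /p (negPf xr); case: pickP => //= no.
  by have [y] := goodP _ xr; rewrite no.
exists p, rk; split.
  split; first by rewrite /p eqxx.
  by move=> x /pP /andP[].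
move=> x /pP /andP[/andP[/andP[axp pc] lp] _]; split=> //.
by case/orP: lp => [|/andP[/eqP -> /eqP ->]]; [left | right].
Qed.
(** * Tree-cotree decompositions *)

Lemma odd_card_addb (T : finType) (A B : pred T) :
  odd #|[set e | A e && B e]| = \big[addb/false]_(e | A e) B e.
Proof.
rewrite -sum1dep_card big_mkcondr (big_morph odd oddD (erefl (odd 0))).
by apply: eq_bigr => e _; case: (B e).
Qed.

Definition incident (V E : finType) (a b : E -> V) (e : E) (x : V) : bool :=
  (a e == x) || (b e == x).

Definition joined (V E : finType) (a b : E -> V) (Q : {set E}) : rel V :=
  [rel x y | [exists e in Q,
     (a e == x) && (b e == y) || (a e == y) && (b e == x)]].

Lemma joined_sym (V E : finType) (a b : E -> V) (Q : {set E}) :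
  symmetric (joined a b Q).
Proof. by move=> x y; apply: eq_existsb => e; rewrite [in RHS]orbC. Qed.

Definition tree_edge (V E : finType) (a b : E -> V) (p : V -> V) x e : bool :=
  (a e == x) && (b e == p x) || (a e == p x) && (b e == x).

(** The choice of an edge to the parent is injective off the root: two vertices sharing their edge
    would be parents of each other, against the rank. The edge [e0] is a default value. *)
Lemma tree_edge_joined (V E : finType) (a b : E -> V) (Q : {set E})
    (p : V -> V) (rk : V -> nat) (root : V) :
    E -> rooted_tree p rk root ->
    (forall x, x != root -> joined a b Q x (p x)) ->
  exists tau : V -> E,
    (forall x, x != root -> tau x \in Q /\ tree_edge a b p x (tau x)) /\
    #|tau @: [set~ root]| = #|V|.-1.
Proof.
move=> e0 treep pQ.
pose tau x := odflt e0 [pick e in Q | tree_edge a b p x e].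
have tauP x : x != root -> tau x \in Q /\ tree_edge a b p x (tau x).
  move=> /pQ/exists_inP[e eQ te]; rewrite /tau; case: pickP => [e' /andP[]//|].
  by move=> /(_ e); rewrite eQ /tree_edge te.
exists tau; split=> //; rewrite card_in_imset ?cardsC1 // => x y.
rewrite !inE => xr yr exy; apply/eqP/contraT => nxy.
have [ltx lty] := (treep.2 _ xr, treep.2 _ yr).
have [_ tx] := tauP _ xr; have [_] := tauP _ yr; rewrite -exy; move: tx.
suff no : ~ (p x = y /\ p y = x).
  rewrite /tree_edge.
  case/orP=> /andP[/eqP-> /eqP->] /orP[] /andP[/eqP e1 /eqP e2].
  - by rewrite e1 eqxx in nxy.
  - by case: no; rewrite -e1.
  - by case: no; rewrite -e2.
  - by rewrite e2 eqxx in nxy.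
by case=> e1 e2; move: ltx lty; rewrite e1 e2; lia.
Qed.

Section Cotree.
Variables (W E F : finType) (s t : E -> W) (l r : E -> F).

(* A closed surface cut into cells: the edge e has ends s e and t e and lies
   between the faces l e and r e.  The second condition says that boundaries of
   faces are cycles mod 2; the third that the faces around a vertex cannot be
   separated without using an edge at that vertex. *)
Definition cell_surface : Prop :=
  [/\ forall e, l e != r e,
      forall (D : {set W}) f,
        ~~ odd #|[set e | ((s e \in D) != (t e \in D)) && incident l r e f]|,
      forall (P : {set F}) w,
        (forall e, incident s t e w -> (l e \in P) = (r e \in P)) ->
        forall e e', incident s t e w -> incident s t e' w ->
          (l e \in P) = (l e' \in P),
      forall x y, connect (joined s t setT) x y
    & (forall w, exists e, incident s t e w) /\
      (forall f, exists e, incident l r e f)].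

Hypothesis surf : cell_surface.

Definition cut_edges (D : {set W}) (P : {set F}) : {set E} :=
  [set e | ((s e \in D) != (t e \in D)) && ((l e \in P) != (r e \in P))].

(** A coboundary of vertices and a boundary of faces meet evenly. Sum the parity condition over the
    faces in [P]: modulo 2, an edge counts once for each of its sides in [P], hence survives exactly
    when it separates [P] from its complement. *)
Lemma odd_cut_edges D P : ~~ odd #|cut_edges D P|.
Proof.
have [lr par _ _ _] := surf.
rewrite odd_card_addb.
pose inc f e := (l e == f) (+) (r e == f).
rewrite (eq_bigr (fun e => \big[addb/false]_(f in P) inc f e)).
  rewrite exchange_big big1 //= => f _.
  apply/negbTE; have := par D f; rewrite odd_card_addb.
  congr (~~ _); apply: eq_bigr => e _; rewrite /incident /inc.
  have := lr e; case: (eqVneq (l e) f) => [->|_];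
    by case: (eqVneq (r e) f).
move=> e _; rewrite big_split /=.
have mem x : (x \in P) = \big[addb/false]_(f in P) (x == f).
  have [xP|xP] := boolP (x \in P).
    by rewrite (bigD1 x) //= eqxx big1 // => f /andP[_] /negPf; rewrite eq_sym.
  by rewrite big1 // => f fP; apply: contraNF xP => /eqP ->.
by rewrite -!mem; case: (_ \in P); case: (_ \in P).
Qed.

(** Walk along the path: the edges around one vertex of [C] lie on the same side of [P], and
    consecutive vertices share an edge. So a connected set that avoids the boundary of [P] has a
    well-defined side. *)
Lemma cell_surface_sides (P : {set F}) (w w' : W) (C : {set W}) :
    (forall x e, x \in C -> incident s t e x -> (l e \in P) = (r e \in P)) ->
    connect [rel a b | [&& a \in C, b \in C & joined s t setT a b]] w w' ->
    w \in C ->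
  forall e e', incident s t e w -> incident s t e' w' ->
    (l e \in P) = (l e' \in P).
Proof.
have [_ _ star _ _] := surf.
move=> bd /connectP[q]; elim: q w => [|a q IHq] w /=.
  by move=> _ -> wC e e'; apply: star => e''; apply: bd.
case/andP=> /and3P[_ aC /exists_inP[e0 _ we0]] pq lw wC e e' ew ew'.
have e0w : incident s t e0 w 
  by case/orP: we0 => /andP[e1 e2]; rewrite /incident ?e1 ?e2 ?orbT.
have e0a : incident s t e0 a 
  by case/orP: we0 => /andP[e1 e2]; rewrite /incident ?e1 ?e2 ?orbT.
rewrite (star P w _ e e0) //; first exact: (IHq a).
by move=> e''; apply: bd.
Qed.

Section SpanningTree.
Variables (p : W -> W) (rk : W -> nat) (root : W) (g : nat).
Hypotheses (treep : rooted_tree p rk root)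
  (p_joined : forall x, x != root -> joined s t setT x (p x))
  (euler : #|E| + 2 = #|W| + #|F| + 2 * g).

(* A dual spanning tree avoiding the spanning tree p leaves out 2g edges.  The
   boundary of a dual subtree is a cycle mod 2 whose edges outside p are among
   these and the stem of the subtree, so it runs inside the root paths of their
   ends. *)
Lemma tree_cotree : exists q rq r0,
  [/\ rooted_tree q rq r0,
      forall f, f != r0 -> joined l r setT f (q f)
    & forall f, exists2 Y : {set W}, #|Y| <= 4 * g + 2 &
        forall e x, (l e \in descendants q f) != (r e \in descendants q f) ->
          incident s t e x -> exists2 y, y \in Y & fconnect p y x].
Proof.
have [lr _ _ conn [incW incF]] := surf.
have [e0 _] := incW root.
have [tau [tauP cardT]] := tree_edge_joined e0 treep p_joined.
pose T := tau @: [set~ root].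
(* Among the tree edges, only [tau x] crosses the boundary of the subtree of [x]: its fundamental
   cut. *)
have tau_cut x y : y != root ->
    (s (tau y) \in descendants p x) != (t (tau y) \in descendants p x) -> y = x.
  move=> /tauP[_ te] cut; apply: (@descendants_cut _ p).
  by case/orP: te cut => /andP[/eqP -> /eqP ->] //; rewrite eq_sym.
have cut_tau x : x != root ->
    (s (tau x) \in descendants p x) != (t (tau x) \in descendants p x).
  move=> xr; have [_ te] := tauP _ xr.
  have := parent_notin_descendants treep xr; have := descendants_refl p x.
  by case/orP: te => /andP[/eqP -> /eqP ->] -> /negPf ->.
(* The cut at x has an even number of boundary edges, one of them tau x. *)
have other x (P : {set F}) : x != root -> (l (tau x) \in P) != (r (tau x) \in P) ->
    exists e, [/\ e \notin T, (l e \in P) != (r e \in P) &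
      (s e \in descendants p x) != (t e \in descendants p x)].
  move=> xr bd; have := odd_cut_edges (descendants p x) P.
  rewrite (cardsD1 (tau x)) inE cut_tau // bd /= negbK => /odd_gt0.
  case/card_gt0P=> e; rewrite !inE => /andP[ne /andP[cute bde]]; exists e.
  have cut : (s e \in descendants p x) != (t e \in descendants p x).
    by rewrite !inE.
  split=> //; apply/negP=> /imsetP[y]; rewrite !inE => yr ey.
  by case/eqP: ne; rewrite ey (tau_cut x y) // -ey.
(* Let [P] be a component of the dual graph without the edges of [T]. No edge outside [T] bounds
   [P], so by [other] no edge of [T] does either, and connectedness of the surface makes [P]
   everything. *)
have dual_conn f f' : connect (joined l r (~: T)) f f'.
  pose P := [set f' | connect (joined l r (~: T)) f f'].
  have closedP e : e \notin T -> (l e \in P) = (r e \in P).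
    move=> eT; rewrite !inE; apply/idP/idP => h; apply: connect_trans h _;
      apply: connect1; apply/exists_inP; exists e; rewrite ?inE // !eqxx //.
    by rewrite orbT.
  have noB e : (l e \in P) = (r e \in P).
    have [/imsetP[x xr ->]|/closedP//] := boolP (e \in T).
    have {}xr : x != root by rewrite !inE in xr.
    apply/eqP/contraT => /(other _ _ xr)[e' [/closedP ->]]; by rewrite eqxx.
  have [e ef] := incF f; have [e' ef'] := incF f'.
  have connw := conn (s e) (s e').
  have eqW : connect [rel a b | [&& a \in [set: W], b \in [set: W]
                              & joined s t setT a b]] (s e) (s e').
    by rewrite (eq_connect (e' := joined s t setT)) // => a b /=; rewrite !inE.
  have sides := cell_surface_sides (P := P) (fun _ e _ _ => noB e) eqW (in_setT _).
  have /sides h : incident s t e (s e) by rewrite /incident eqxx.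
  have /h eq : incident s t e' (s e') by rewrite /incident eqxx.
  have lP e1 f1 : incident l r e1 f1 -> (f1 \in P) = (l e1 \in P).
    by case/orP=> /eqP <- //; rewrite noB.
  have : f \in P by rewrite inE connect0.
  by rewrite (lP _ _ ef) eq -(lP _ _ ef') inE.
pose r0 := l e0.
have [q [rq [treeq qP]]] : exists q rq, rooted_tree q rq r0 /\
    forall f, f != r0 -> joined l r (~: T) f (q f).
  (* With one cell, and two levels that merely single out [r0], this gives a shortest-path tree
     towards [r0]. *)
  have [||q [rq [treeq qP]]] := @layered_tree F (joined l r (~: T))
      (fun f => f != r0) r0 (fun _ => setT).
  - move=> f fr; exists r0; first by rewrite eqxx fr.
    rewrite (eq_connect (e' := joined l r (~: T))) // => a b /=.
    by rewrite !inE.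
  - move=> f f' -> _; case: (f' != r0); by [left | right].
  by exists q, rq; split=> // f /qP[].
have [sg [sgP cardS]] := tree_edge_joined e0 treeq qP.
pose Sg := sg @: [set~ r0].
have disj : [disjoint T & Sg].
  rewrite disjoint_sym disjoints_subset; apply/subsetP=> e /imsetP[f].
  by rewrite !inE => /sgP[]; rewrite inE => ? _ ->.
pose X := ~: (T :|: Sg).
(* The two trees use [#|W| - 1] and [#|F| - 1] edges; Euler's formula counts the rest. *)
have cardX : #|X| <= 2 * g.
  have := cardsC (T :|: Sg); rewrite cardsU (disjoint_setI0 disj) cards0 subn0.
  rewrite cardT cardS -/X.
  have W0 : 0 < #|W| by apply/card_gt0P; exists root.
  have F0 : 0 < #|F| by apply/card_gt0P; exists r0.
  by lia.
exists q, rq, r0; split=> //.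
  move=> f /qP/exists_inP[e _ h]; by apply/exists_inP; exists e.
move=> f; pose Q := sg f |: X; pose P := descendants q f.
have cardQ : #|Q| <= 2 * g + 1.
  by rewrite cardsU1 addnC leq_add // leq_b1.
have bdQ e : (l e \in P) != (r e \in P) -> e \notin T -> e \in Q.
  move=> bd eT; rewrite !inE (negPf eT) /=.
  have [/imsetP[f' ]|_] := boolP (e \in Sg); last by rewrite orbT.
  rewrite !inE => f'r0 ef'; have [_ te] := sgP _ f'r0.
  suff <- : f' = f by rewrite ef' eqxx.
  apply: (@descendants_cut _ q); move: bd; rewrite ef' /P.
  by case/orP: te => /andP[/eqP -> /eqP ->] //; rewrite eq_sym.
(* Both ends of the stem [sg f] and of the at most 2g leftover edges: 2 (2g + 1) vertices. *)
exists ((s @: Q) :|: (t @: Q)).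
  apply: leq_trans (leq_card_setU _ _) _.
  by have := leq_imset_card s Q; have := leq_imset_card t Q; lia.
move=> e x bd ex.
have endQ e1 x1 : e1 \in Q -> incident s t e1 x1 -> x1 \in s @: Q :|: t @: Q.
  by move=> e1Q; case/orP=> /eqP <-; rewrite inE imset_f ?orbT.
have [/imsetP[y]|eT] := boolP (e \in T); last first.
  by exists x; [apply: endQ ex; apply: bdQ | exact: connect0].
rewrite !inE => yr ey; move: bd; rewrite ey => /(other _ _ yr).
case=> e1 [e1T bd1 cut1].
(* The non-tree boundary edge [e1] crosses the fundamental cut of [tau y], so one of its ends lies
   below [y]; the root path from there runs through [y] and [p y], the two ends of [e]. *)
have [z ez zy] : exists2 z, incident s t e1 z & z \in descendants p y.
  have [sy|sy] := boolP (s e1 \in descendants p y).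
    by exists (s e1); rewrite // /incident eqxx.
  exists (t e1); first by rewrite /incident eqxx orbT.
  by move: cut1; rewrite (negPf sy); case: (t e1 \in _).
rewrite inE in zy.
exists z; first by apply: endQ ez; apply: bdQ.
have [_ te] := tauP _ yr.
have : x = y \/ x = p y.
  move: ex; rewrite ey => ex.
  by case/orP: te ex => /andP[/eqP e2 /eqP e3] /orP[] /eqP <-;
     rewrite ?e2 ?e3; auto.
case=> -> //; by apply: connect_trans zy (fconnect1 _ _).
Qed.
End SpanningTree.
End Cotree.
(** * Growth in expanders *)

Section Expander.
Variables (V : finType) (adj : rel V) (d K : nat).

(** [Y] may take vertices from both sides of the cut and [A] may be the larger side; this is the
    form in which separators arise here. *)
Definition vertex_expander : Prop := forall A Y : {set V},
  (forall a b, a \in A -> b \notin A -> adj a b -> (a \in Y) || (b \in Y)) ->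
  #|A| <= K * #|Y| \/ #|~: A| <= K * #|Y|.

Definition closed_nbhd (A : {set V}) : {set V} :=
  \bigcup_(v in A) (v |: [set u | adj v u]).

Definition inside (T : finType) (e : rel T) (C : {set T}) : rel T :=
  [rel a b | [&& a \in C, b \in C & e a b]].

Hypotheses (adj_sym : symmetric adj)
  (degree_le : forall v, #|[set u | adj v u]| <= d)
  (expanding : vertex_expander).

Lemma card_closed_nbhd (A : {set V}) : #|closed_nbhd A| <= d.+1 * #|A|.
Proof.
apply: leq_trans (card_bigcup_le _ _) _; rewrite mulnC -sum_nat_const.
apply: leq_sum => v _; rewrite cardsU1 -add1n leq_add //; exact: leq_b1.
Qed.

Lemma sub_closed_nbhd (A : {set V}) : A \subset closed_nbhd A.
Proof. by apply/subsetP=> v vA; apply/bigcupP; exists v; rewrite // setU11. Qed.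

Lemma closed_nbhd_adj (A : {set V}) u v : u \in A -> adj u v -> v \in closed_nbhd A.
Proof. by move=> uA uv; apply/bigcupP; exists u; rewrite // !inE uv orbT. Qed.

(** A vertex may be adjacent to itself, since loops are allowed. *)
Definition independent (I : {set V}) : bool :=
  [forall u in I, forall v in I, adj u v ==> (u == v)].

Lemma independentP (I : {set V}) : reflect {in I &, forall u v, adj u v -> u = v}
  (independent I).
Proof.
apply: (iffP forall_inP) => [h u v uI vI uv|h u uI].
  by have /forall_inP/(_ v vI)/implyP/(_ uv)/eqP := h u uI.
by apply/forall_inP=> v vI; apply/implyP=> uv; apply/eqP; apply: h.
Qed.

Definition max_independent (Q : {set V}) : {set V} :=
  [arg max_(I > set0 | (I \subset Q) && independent I) #|I|].

(** A vertex of [Q] that is not dominated could be added, against maximality. *)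
Lemma max_independentP Q : [/\ max_independent Q \subset Q,
  independent (max_independent Q) & Q \subset closed_nbhd (max_independent Q)].
Proof.
rewrite /max_independent; case: arg_maxnP => [|I /andP[IQ indI] maxI].
  by rewrite sub0set; apply/independentP=> u v; rewrite inE.
split=> //; apply/subsetP=> q qQ; apply/contraT=> qN.
have qI : q \notin I by apply: contra qN; apply: (subsetP (sub_closed_nbhd I)).
suff /maxI : (q |: I \subset Q) && independent (q |: I).
  by rewrite cardsU1 qI add1n /= ltnn.
rewrite subUset sub1set qQ IQ /=; apply/independentP=> u v.
have nadj w : w \in I -> adj w q -> False.
  by move=> wI wq; rewrite (closed_nbhd_adj wI wq) in qN.
case/setU1P=> [->|uI] /setU1P[->|vI] // uv.
- by case: (nadj v); rewrite // adj_sym.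
- by case: (nadj u).
- by apply: (independentP _ indI).
Qed.

(** One vertex is added at a time: expansion with [Y] empty says that a nonempty proper subset has a
    neighbour outside. *)
Lemma connected_subset (v0 : V) b : 0 < b -> b <= #|V| ->
  exists C : {set V}, [/\ #|C| = b, v0 \in C &
    forall v, v \in C -> connect (inside adj C) v v0].
Proof.
elim: b => // -[_ _ _|b IHb _ leb].
  exists [set v0]; rewrite cards1 set11; split=> // v /set1P ->; exact: connect0.
have [//|C [cardC v0C connC]] := IHb _ (ltnW leb).
have [a [c [aC cC ac]]] : exists a c, [/\ a \in C, c \notin C & adj a c].
  have [/exists_inP[a aC /existsP[c /andP[cC ac]]]|no] :=
      boolP [exists a in C, exists c, (c \notin C) && adj a c].
    by exists a, c.
  have [||] := expanding (A := C) (Y := set0).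
  - move=> a c aC cC ac; case/negP: no; apply/exists_inP; exists a => //.
    by apply/existsP; exists c; rewrite cC.
  - by rewrite cards0 muln0 cardC.
  - by rewrite cards0 muln0; have := cardsC C; rewrite cardC; lia.
have sub : subrel (inside adj C) (inside adj (c |: C)).
  by move=> x y /and3P[xC yC xy]; rewrite /inside /= !inE xC yC xy !orbT.
exists (c |: C); rewrite cardsU1 cC cardC !inE v0C orbT; split=> // v.
have sub' x : x \in C -> connect (inside adj (c |: C)) x v0.
  by move=> xC; apply: connect_sub (connC x xC) => y z /sub; apply: connect1.
case/setU1P=> [->|/sub' //]; apply: connect_trans (sub' a aC).
by apply: connect1; rewrite /inside /= !inE eqxx aC orbT adj_sym.
Qed.

(** Taking only independent new neighbours slows the growth by a factor of at most [d.+1], but makes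
    the regions of the vertices added in one step pairwise disjoint. *)
Definition grow (B : {set V}) : {set V} :=
  B :|: max_independent (closed_nbhd B :\: B).

(* Expansion makes each step gain #|B| / (K * d.+1) vertices, as long as both
   the current set and its complement have at least #|B| of them. *)
Lemma card_iter_grow (B : {set V}) j :
  #|~: iter j grow B| <= #|B| \/
  j * #|B| <= K * d.+1 * #|iter j grow B|.
Proof.
elim: j => [|j IHj]; first by right.
rewrite iterS; set C := iter j grow B in IHj *.
have subB : B \subset C.
  by rewrite /C; elim: (j) => //= i /subset_trans -> //; apply: subsetUl.
have [small|big] := leqP #|~: C| #|B|.
  left; apply: leq_trans small; apply: subset_leq_card.
  by rewrite setCS subsetUl.
case: IHj => [|IHj]; first by rewrite leqNgt big.
have [subI _ domI] := max_independentP (closed_nbhd C :\: C).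
rewrite /grow; set I := max_independent _ in subI domI *.
have disj : [disjoint C & I].
  by rewrite disjoint_sym disjoints_subset (subset_trans subI) // setDE subsetIr.
right; rewrite cardsU (disjoint_setI0 disj) cards0 subn0.
have cardI : #|closed_nbhd C :\: C| <= d.+1 * #|I|.
  exact: leq_trans (subset_leq_card domI) (card_closed_nbhd _).
have leBC := subset_leq_card subB.
suff : #|B| <= K * #|closed_nbhd C :\: C|.
  move=> le; have : K * #|closed_nbhd C :\: C| <= K * (d.+1 * #|I|).
    by rewrite leq_mul2l cardI orbT.
  by rewrite mulnDr -!mulnA mulSn; lia.
have [||] := expanding (A := C) (Y := closed_nbhd C :\: C); last 2 first.
- exact: leq_trans.
- by apply: leq_trans; apply: ltnW.
move=> a c aC cC ac; apply/orP; right; rewrite inE cC /=.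
exact: closed_nbhd_adj ac.
Qed.

(** [lam v] is the growth step at which [v] is reached from a connected seed of size [b], and [k.+1]
    if it is not reached within [k] steps. The number [k] of steps depends on [M], [K] and [d] only,
    while the seed and the unreached part are fractions of about 1/M. *)
Lemma layering M : 0 < K -> 1 < M -> 0 < #|V| ->
  let b := (#|V| %/ M).+1 in let k := M * (K * d.+1) in
  exists (lam : V -> nat) (v0 : V),
  [/\ lam v0 = 0 /\ forall v, lam v = 0 ->
        connect (inside adj [set v | lam v == 0]) v v0,
      forall v, 0 < lam v <= k -> exists2 u, adj v u & lam u < lam v,
      forall u v, 0 < lam u <= k -> lam u = lam v -> adj u v -> u = v,
      #|[set v | lam v == 0]| <= b
    & #|[set v | k < lam v]| <= b].
Proof.
move=> K0 M1 V0 b k.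
have /card_gt0P[v0 _] := V0.
have lebV : b <= #|V| by rewrite /b ltn_Pdiv.
have ltVb : #|V| < M * b by rewrite /b mulnC ltn_ceil // ltnW.
have [//|C [cardC v0C connC]] := connected_subset v0 _ lebV.
pose B j := iter j grow C.
pose lam v := find (fun j => v \in B j) (iota 0 k.+1).
have lamB v j : j <= k -> v \in B j -> lam v <= j.
  move=> jk vB; rewrite leqNgt; apply/negP=> ltj.
  by have := before_find 0 ltj; rewrite nth_iota ?add0n ?vB // ltnS.
have Blam v : lam v <= k -> v \in B (lam v).
  move=> lk; have hasv : has (fun j => v \in B j) (iota 0 k.+1).
    by rewrite has_find size_iota ltnS.
  by have := nth_find 0 hasv; rewrite nth_iota.
have zeroE : [set v | lam v == 0] = C.
  apply/setP=> v; rewrite inE; apply/eqP/idP => [l0|vC].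
    by have := Blam v; rewrite l0; apply.
  by apply/eqP; rewrite -leqn0; apply: lamB.
have stepI v : 0 < lam v <= k -> exists j,
    lam v = j.+1 /\ v \in max_independent (closed_nbhd (B j) :\: B j).
  case/andP; case lv : (lam v) => [//|j] _ ltj; exists j; split=> //.
  have := Blam v; rewrite lv => /(_ ltj); rewrite [B _]iterS -/(B j) inE.
  by case/orP=> // /(lamB _ _ (ltnW ltj)); rewrite lv ltnn.
exists lam, v0; rewrite zeroE cardC; split=> //.
- split; first by apply/eqP; rewrite -leqn0; apply: lamB.
  by move=> v /eqP l0; apply: connC; rewrite -zeroE inE.
- move=> v lv; have [j [lj]] := stepI v lv.
  have [/subsetP sub _ _] := max_independentP (closed_nbhd (B j) :\: B j).
  move=> /sub; rewrite inE => /andP[vB /bigcupP[u uB]].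
  rewrite !inE => /orP[/eqP uv|uv]; first by rewrite uv uB in vB.
  exists u; first by rewrite adj_sym.
  by rewrite lj ltnS; apply: lamB => //; case/andP: lv; rewrite lj => _ /ltnW.
- move=> u v lu luv; have [j [lj uI]] := stepI u lu.
  have := stepI v; rewrite -luv => /(_ lu)[j' []]; rewrite lj => -[<-] vI.
  have [_ /independentP ind _] := max_independentP (closed_nbhd (B j) :\: B j).
  exact: ind.
have -> : [set v | k < lam v] = ~: B k.
  apply/setP=> v; rewrite !inE ltnNge; congr (~~ _).
  apply/idP/idP => [lk|]; last exact: lamB.
  rewrite /B -(subnK lk) iterD -/(B (lam v)).
  elim: (k - lam v) => [|i IHi] /=; first exact: Blam.
  by rewrite inE IHi.
(* In the other alternative [k * b <= K * d.+1 * #|V|], that is [M * b <= #|V|], although [b]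
   exceeds [#|V| / M]. *)
have [|le] := card_iter_grow C k; first by rewrite cardC.
have := max_card (mem (iter k grow C)); move: le; rewrite cardC /k mulnAC.
rewrite mulnC leq_mul2l muln_eq0 eqn0Ngt K0 /= -/b => le1 le2.
by move: ltVb; rewrite ltnNge (leq_trans le1 le2).
Qed.
End Expander.
(** * Graphs of regions on a surface *)

(** In [region_graph_bound], [10 * (K.+1 * d.+2)] is [M], and its product with [K * d.+1] is the
    number [k] of layers. The summands are twice the terms of the centroid estimate that are not
    absorbed. *)
Definition region_constant (d K : nat) : nat :=
  10 * (K.+1 * (d.+2 + 4 * (d.+1 * (10 * (K.+1 * d.+2) * (K * d.+1))))) +
  16 * d.+1.

Section RegionGraph.
Variables (V : finType) (adj : rel V) (d K : nat).
Variables (W E F : finType) (s t : E -> W) (l r : E -> F) (g : nat).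
Variable S : V -> {set W}.

Hypotheses (adj_sym : symmetric adj)
  (degree_le : forall v, #|[set u | adj v u]| <= d)
  (expanding : vertex_expander adj K) (K_gt0 : 0 < K) (V_gt0 : 0 < #|V|).
Hypotheses (surf : cell_surface s t l r)
  (euler : #|E| + 2 = #|W| + #|F| + 2 * g)
  (face_le4 : forall f, #|[set e | incident l r e f]| <= 4).
Hypotheses
  (S_connected : forall v x y, x \in S v -> y \in S v ->
     connect (inside (joined s t setT) (S v)) x y)
  (S_nonempty : forall v, exists x, x \in S v)
  (S_adj : forall u v, adj u v -> exists2 x, x \in S u & x \in S v)
  (S_meet : forall u v x, x \in S u -> x \in S v -> u = v \/ adj u v).

Definition regions (x : W) : {set V} := [set v | x \in S v].

Lemma regions_closed_nbhd (A : {set V}) x u v :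
  u \in A -> x \in S u -> x \in S v -> v \in closed_nbhd adj A.
Proof.
move=> uA xu xv; case: (S_meet xu xv) => [<-|uv].
  exact: (subsetP (sub_closed_nbhd _ _)).
exact: closed_nbhd_adj uv.
Qed.

(** Regions through a common point belong to equal or adjacent vertices, hence to the closed
    neighbourhood of any one of them. *)
Lemma card_regions x : #|regions x| <= d.+1.
Proof.
have [->|[v]] := set_0Vmem (regions x); first by rewrite cards0.
rewrite inE => xv; rewrite -[d.+1]muln1 -(cards1 v).
apply: leq_trans (card_closed_nbhd degree_le _); apply: subset_leq_card.
by apply/subsetP=> u; rewrite inE; apply: regions_closed_nbhd xv; rewrite set11.
Qed.

(** * A spanning tree whose root paths meet few regions *)

Section RootPaths.
Variables (k : nat) (lam : V -> nat) (v0 : V).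
Hypotheses (lam_v0 : lam v0 = 0)
  (zero_connected : forall v, lam v = 0 ->
     connect (inside adj [set v | lam v == 0]) v v0)
  (lam_step : forall v, 0 < lam v <= k -> exists2 u, adj v u & lam u < lam v)
  (lam_indep : forall u v,
     0 < lam u <= k -> lam u = lam v -> adj u v -> u = v).

(** The lowest layer among the regions through [x], or [k.+1] if [x] lies only in regions of
    unreached vertices or in none. *)
Definition depth (x : W) : nat :=
  find (fun j => [exists v, (lam v == j) && (x \in S v)]) (iota 0 k.+1).

Lemma depth_le x v : x \in S v -> lam v <= k -> depth x <= lam v.
Proof.
move=> xv lk; rewrite leqNgt; apply/negP=> ltl.
have := before_find 0 ltl; rewrite nth_iota // => /negbT/existsP[].
by exists v; rewrite eqxx.
Qed.

Lemma depth_region x : depth x <= k -> exists2 v, lam v = depth x & x \in S v.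
Proof.
move=> dk; pose a := fun j => [exists v, (lam v == j) && (x \in S v)].
have hasd : has a (iota 0 k.+1) by rewrite has_find size_iota ltnS.
have := nth_find 0 hasd; rewrite nth_iota // => /existsP[v /andP[/eqP lv xv]].
by exists v.
Qed.

Definition owner (x : W) : V :=
  odflt v0 [pick v | (lam v == depth x) && (x \in S v)].

Lemma ownerP x : depth x <= k -> lam (owner x) = depth x /\ x \in S (owner x).
Proof.
move=> /depth_region[v lv xv]; rewrite /owner.
case: pickP => [u /andP[/eqP]//|/(_ v)]; by rewrite lv eqxx xv.
Qed.

Lemma depth_max x : depth x <= k.+1.
Proof. by rewrite -[k.+1](size_iota 0) find_size. Qed.

Lemma depth_owner x y : depth x <= k -> y \in S (owner x) -> depth y <= depth x.
Proof.
move=> dk yx; have [<- _] := ownerP dk; apply: depth_le => //.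
by rewrite (ownerP dk).1.
Qed.

(** The owners of [x] and [y] are in the same layer and both regions contain [y], so they are equal
    or adjacent; independence of the layer leaves equality. *)
Lemma owner_eq x y : 0 < depth x <= k -> y \in S (owner x) ->
  depth y = depth x -> owner y = owner x.
Proof.
move=> dk yx dxy; have [dx xS] := ownerP (proj2 (andP dk)).
have [|dy yS] := @ownerP y; first by rewrite dxy; case/andP: dk.
have [//|yx_adj] := S_meet yS yx.
by apply: lam_indep yx_adj; rewrite ?dx ?dy dxy.
Qed.

Definition zone : {set W} := \bigcup_(v in [set v | lam v == 0]) S v.

Lemma zoneP x : (x \in zone) = (depth x == 0).
Proof.
apply/bigcupP/eqP => [[v]|d0].
  rewrite inE => /eqP lv xv; apply/eqP; rewrite -leqn0 -lv.
  by apply: depth_le; rewrite ?lv.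
have [|lx xv] := @ownerP x; first by rewrite d0.
by exists (owner x); rewrite // inE lx d0.
Qed.

Lemma connect_inside_sub (C D : {set W}) : C \subset D ->
  forall x y, connect (inside (joined s t setT) C) x y ->
  connect (inside (joined s t setT) D) x y.
Proof.
move=> /subsetP sub x y; apply: connect_sub => a b /and3P[aC bC ab].
by apply: connect1; rewrite /inside /= !sub.
Qed.

Lemma zone_connected x y : x \in S v0 -> y \in zone ->
  connect (inside (joined s t setT) zone) y x.
Proof.
move=> xv0 /bigcupP[v]; rewrite inE => /eqP lv yv.
have subz u : lam u = 0 -> S u \subset zone.
  by move=> lu; apply: bigcup_sup; rewrite inE lu.
have /connectP[q] := zero_connected lv.
elim: q v lv y yv => [|u q IHq] v lv y yv /=.
  move=> _ v0v; apply: connect_inside_sub (subz v lv) _ _ _.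
  by apply: S_connected; rewrite // -v0v.
case/andP=> /and3P[_]; rewrite inE => /eqP lu vu pq v0q.
have [z zv zu] := S_adj vu; apply: connect_trans (IHq u lu z zu pq v0q).
by apply: connect_inside_sub (subz v lv) _ _ _; apply: S_connected.
Qed.

(** Along a root path the depth never increases, and at a depth between 1 and [k] the path stays in
    the region of one owner until the depth drops. So there are at most [k] owners, collected in
    [Q]. Any region met at such a point is near the owner; regions met at depth 0 or [k.+1] are
    charged to a set common to all paths. *)
Lemma tree_few_regions : exists p rk root,
  [/\ rooted_tree p rk root,
      forall x, x != root -> joined s t setT x (p x)
    & forall x, exists2 Q : {set V}, #|Q| <= k &
        forall y v, fconnect p x y -> y \in S v ->
          v \in closed_nbhd adj [set v | lam v == 0] :|: [set v | k < lam v]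
                  :|: closed_nbhd adj Q].
Proof.
have [root rootS] := S_nonempty v0.
have depth_root : depth root = 0.
  by apply/eqP; rewrite -zoneP; apply/bigcupP; exists v0; rewrite // inE lam_v0.
(* The root has a level of its own, so that the other points of depth 0 also have a lower level to
   reach. *)
pose lev x := if x == root then 0 else (depth x).+1.
(* Where a path may move before its depth drops: the union of the seed regions, the region of the
   owner, or anywhere. *)
pose cell x := if depth x == 0 then zone else
  if depth x <= k then S (owner x) else setT.
have [||p [rk [treep pP]]] := @layered_tree W (joined s t setT) lev root cell.
- move=> x xr; rewrite {2}/lev (negPf xr) -/(inside _ _).
  have [d0|d0] := posnP (depth x).
    exists root; first by rewrite /lev eqxx.
    rewrite /cell d0 eqxx; apply: zone_connected => //.
    by rewrite zoneP d0.
  rewrite /cell eqn0Ngt d0 /=.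
  have [dk|dk] := leqP (depth x) k; last first.
    exists root; first by rewrite /lev eqxx.
    have [_ _ _ conn _] := surf; rewrite (eq_connect (e' := joined s t setT)) //.
    by move=> a b; rewrite /inside /= !inE.
  have [lx xS] := ownerP dk.
  have [|u xu lu] := @lam_step (owner x); first by rewrite lx d0.
  have [y yx yu] := S_adj xu; exists y; last exact: S_connected.
  rewrite /lev; case: eqP => // _; rewrite ltnS -lx (leq_ltn_trans _ lu) //.
  by apply: depth_le; rewrite // (leq_trans (ltnW lu)) // lx.
- move=> x y xr; rewrite /lev (negPf xr); have [->|yr] := eqVneq y root.
    by left.
  rewrite ltnS /cell; have [d0|d0] := eqVneq (depth x) 0.
    by rewrite zoneP d0 => /eqP ->; right.
  have [dk|dk] := leqP (depth x) k => [yx|_].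
    have le := depth_owner dk yx; rewrite leq_eqVlt in le.
    case/orP: le => [/eqP dxy|->]; last by left.
    by right; rewrite dxy (negPf d0) dk (owner_eq _ yx dxy) // lt0n d0.
  have dx : depth x = k.+1 by apply/eqP; rewrite eqn_leq dk depth_max.
  have := depth_max y; rewrite dx leq_eqVlt ltnS => /orP[/eqP ->|]; last by left.
  by right; rewrite ltnn.
exists p, rk, root; split=> //; first by move=> x /pP[].
move=> x.
(* Strengthened for the induction: [Q] contains the owner of [x], and a new owner is paid for by a
   drop of the depth. The cap [k] is for points of depth [k.+1], whose owner is not recorded. *)
have : exists2 Q : {set V},
   #|Q| <= minn (depth x) k /\ (0 < depth x <= k -> owner x \in Q) &
   forall y v, fconnect p x y -> y \in S v ->
          v \in closed_nbhd adj [set v | lam v == 0] :|: [set v | k < lam v]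
                  :|: closed_nbhd adj Q.
  elim: (rk x).+1 {-2}x (ltnSn (rk x)) => // n IHn {}x ltn.
  have near0 y v : depth y = 0 -> y \in S v ->
      v \in closed_nbhd adj [set v | lam v == 0].
    move=> dy; have [|ly yS] := @ownerP y; first by rewrite dy.
    by apply: regions_closed_nbhd yS; rewrite inE ly dy.
  have [->|xr] := eqVneq x root.
    exists set0; first by rewrite cards0 depth_root.
    move=> y v /connectP[q]; elim: q => [_ ->|a q IHq] /=.
      by move=> /(near0 _ _ depth_root); rewrite !inE => ->.
    by case/andP=> /eqP <-; rewrite treep.1.
  have [_ pxc _] := pP _ xr.
  have [|Q [cardQ ownQ] QP] := IHn (p x).
    by rewrite (leq_trans (treep.2 _ xr)).
  have path_split y : fconnect p x y -> y = x \/ fconnect p (p x) y.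
    have [->|nxy] := eqVneq x y; first by left.
    by move=> /fconnect_parent h; right; apply: h.
  move: pxc; rewrite /cell; have [d0|d0] := eqVneq (depth x) 0.
    rewrite zoneP => /eqP dp; exists Q.
      by rewrite d0; split=> //; rewrite dp in cardQ.
    move=> y v /path_split[->|] //; last exact: QP.
    by move=> /(near0 _ _ d0); rewrite !inE => ->.
  have [dk pxS|dk _] := leqP (depth x) k; last first.
    exists Q.
      split; last by rewrite andbF.
      by rewrite (leq_trans cardQ) ?geq_minr.
    move=> y v /path_split[->|] //; last exact: QP.
    move=> xv; rewrite !inE; apply/orP; left; apply/orP; right.
    rewrite ltnNge; apply: contraL dk => lk; rewrite -leqNgt.
    by rewrite (leq_trans _ lk) // depth_le.
  have le := depth_owner dk pxS; rewrite leq_eqVlt in le.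
  have dx0 : 0 < depth x <= k by rewrite lt0n d0.
  have nearS v (Q' : {set V}) : owner x \in Q' -> x \in S v ->
      v \in closed_nbhd adj Q'.
    by move=> ?; apply: regions_closed_nbhd (ownerP dk).2.
  case/orP: le => [/eqP dpx|lt].
    have eq_own := owner_eq dx0 pxS dpx.
    have xQ : owner x \in Q by rewrite -eq_own; apply: ownQ; rewrite dpx.
    exists Q; first by split=> //; rewrite -dpx (leq_trans cardQ) ?geq_minl.
    move=> y v /path_split[->|] //; last exact: QP.
    by move=> /(nearS _ _ xQ) h; rewrite !in_setU h !orbT.
  exists (owner x |: Q).
    rewrite setU11; split=> //; rewrite cardsU1.
    have := leq_trans cardQ (geq_minl _ _).
    by have := leq_b1 (owner x \notin Q); lia.
  move=> y v /path_split[->|] //.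
    by move=> /(nearS _ _ (setU11 _ Q)) h; rewrite !in_setU h !orbT.
  move=> /QP h /h; rewrite !in_setU => /orP[->//|vQ].
  have -> : v \in closed_nbhd adj (owner x |: Q); last by rewrite !orbT.
  have /bigcupP[u uQ vu] := vQ; apply/bigcupP; exists u => //.
  by rewrite inE uQ orbT.
by case=> Q [cardQ _] QP; exists Q => //; apply: leq_trans cardQ (geq_minr _ _).
Qed.
End RootPaths.

(** The region of a vertex outside [H] meets no boundary edge of [P], so it has one side, read off
    at [ev v]. Adjacent regions meet, hence [H] covers the adjacencies between the two sides and
    expansion applies; [K.+1] instead of [K] accounts for [H] itself. *)
Lemma vertex_cut_sides (P : {set F}) (H : {set V}) (ev : V -> E) (xv : V -> W) :
    (forall v, xv v \in S v /\ incident s t (ev v) (xv v)) ->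
    (forall e x v, (l e \in P) != (r e \in P) -> incident s t e x ->
       x \in S v -> v \in H) ->
  #|[set v | l (ev v) \in P]| <= K.+1 * #|H| \/
  #|[set v | l (ev v) \notin P]| <= K.+1 * #|H|.
Proof.
move=> xvP HP.
have side v x e : v \notin H -> x \in S v -> incident s t e x ->
    (l e \in P) = (l (ev v) \in P).
  move=> vH xS ex; have [xvS inc] := xvP v.
  apply: (cell_surface_sides surf (C := S v)) ex inc => //; last first.
    exact: S_connected.
  by move=> y e' yv ey; apply/eqP; apply: contraNT vH => /HP; apply; eauto.
have [_ _ _ _ [incW _]] := surf.
pose A := [set v | (v \notin H) && (l (ev v) \in P)].
have [||] := expanding (A := A) (Y := H).
- move=> a b; rewrite !inE => /andP[aH aP]; rewrite (negPf aH) /=.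
  have [//|bH /= bP ab] := boolP (b \in H).
  have [x xa xb] := S_adj ab; have [e ex] := incW x.
  by case/negP: bP; rewrite -(side _ _ _ bH xb ex) (side _ _ _ aH xa ex).
- move=> leA; left; have : [set v | l (ev v) \in P] \subset A :|: H.
    by apply/subsetP=> v; rewrite !inE => ->; rewrite andbT orNb.
  by move/subset_leq_card/leq_trans; apply; rewrite cardsU mulSn; lia.
move=> leA; right; have : [set v | l (ev v) \notin P] \subset ~: A.
  by apply/subsetP=> v; rewrite !inE => /negPf ->; rewrite andbF.
by move/subset_leq_card/leq_trans; apply; rewrite mulSn; lia.
Qed.

Lemma region_graph_bound : #|V| <= region_constant d K * g.+1.
Proof.
pose M := 10 * (K.+1 * d.+2); pose k := M * (K * d.+1).
have M1 : 1 < M by rewrite /M; lia.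
have [lam [v0 [[lam0 zc] lstep lind card0 cardfar]]] :=
  layering adj_sym degree_le expanding K_gt0 M1 V_gt0.
rewrite -/k in lstep lind cardfar.
set b := (#|V| %/ M).+1 in card0 cardfar.
have [p [rk [root [treep pj few]]]] := tree_few_regions lam0 zc lstep lind.
have [q [rq [r0 [treeq qj cutq]]]] := tree_cotree surf treep pj euler.
have [_ _ _ _ [incW _]] := surf.
have /fin_all_exists[xv xvS] := S_nonempty.
have /fin_all_exists[ev evx] : forall v, exists e, incident s t e (xv v).
  by move=> v; apply: incW.
(* The regions charged to every root path alike; counted once for a whole cut, not once for each
   path. *)
pose B := closed_nbhd adj [set v | lam v == 0] :|: [set v | k < lam v].
have cardB : #|B| <= d.+2 * b.
  apply: leq_trans (leq_card_setU _ _) _; rewrite [d.+2 * b]mulSn addnC.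
  apply: leq_add => //; apply: leq_trans (card_closed_nbhd degree_le _) _.
  by rewrite leq_mul2l card0 orbT.
pose H0 := d.+2 * b + (4 * g + 2) * (d.+1 * k).
have cut f : #|[set v | l (ev v) \in descendants q f]| <= K.+1 * H0 \/
             #|[set v | l (ev v) \notin descendants q f]| <= K.+1 * H0.
  have [Y cardY bdY] := cutq f.
  have /fin_all_exists2[Q cardQ QP] := few.
  pose H := B :|: \bigcup_(y in Y) closed_nbhd adj (Q y).
  have cardH : #|H| <= H0.
    apply: leq_trans (leq_card_setU _ _) _; apply: leq_add => //.
    apply: leq_trans (card_bigcup_le _ _) _.
    apply: (@leq_trans (#|Y| * (d.+1 * k))); last by rewrite leq_mul2r cardY orbT.
    rewrite -sum_nat_const; apply: leq_sum => y _.
    apply: leq_trans (card_closed_nbhd degree_le _) _.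
    by rewrite leq_mul2l cardQ orbT.
  have HP e x v : (l e \in descendants q f) != (r e \in descendants q f) ->
       incident s t e x -> x \in S v -> v \in H.
    move=> bd ex xv'; have [y yY yx] := bdY _ _ bd ex.
    have := QP y x v yx xv'; rewrite [v \in H]in_setU in_setU -/B.
    case/orP=> [->//|vQ]; apply/orP; right; apply/bigcupP; by exists y.
  have [] := vertex_cut_sides (fun v => conj (xvS v) (evx v)) HP => le;
    [left | right]; by apply: leq_trans le _; rewrite leq_mul2l cardH orbT.
(* Distinct children of [f] lie across distinct sides of the square [f]. *)
have deg f : #|[set c | (c != r0) && (q c == f)]| <= 4.
  apply: leq_trans (face_le4 f).
  pose other e := if l e == f then r e else l e.
  apply: leq_trans (leq_imset_card other _); apply: subset_leq_card.
  apply/subsetP=> c; rewrite !inE => /andP[/qj/exists_inP[e _ ce] /eqP qc].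
  have [lr _ _ _ _] := surf; apply/imsetP; exists e.
    rewrite inE /incident -qc.
    by case/orP: ce => /andP[e1 e2]; rewrite ?e1 ?e2 ?orbT.
  have := lr e; rewrite /other -qc.
  by case/orP: ce => /andP[/eqP -> /eqP ->]; [move/negPf-> | rewrite eqxx].
have wgt f : #|[set v | l (ev v) == f]| <= 8 * d.+1.
  have : [set v | l (ev v) == f] \subset
      \bigcup_(e in [set e | incident l r e f])
         (regions (s e) :|: regions (t e)).
    apply/subsetP=> v; rewrite inE => lv; apply/bigcupP; exists (ev v).
      by rewrite inE /incident lv.
    have := evx v; rewrite !inE => /orP[] /eqP -> ; by rewrite xvS ?orbT.
  move/subset_leq_card/leq_trans; apply; apply: leq_trans (card_bigcup_le _ _) _.
  apply: (@leq_trans (4 * (2 * d.+1))); last by rewrite mulnA.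
  apply: leq_trans (leq_mul (face_le4 f) (leqnn _)); rewrite -sum_nat_const.
  apply: leq_sum => e _; apply: leq_trans (leq_card_setU _ _) _.
  by have := card_regions (s e); have := card_regions (t e); lia.
have := tree_centroid treeq deg wgt cut.
have := leq_trunc_div #|V| M; rewrite /H0 /b.
set n := #|V|; set c := n %/ M => le1 le2.
rewrite /region_constant -/M -/k; set x := d.+1 * k in le2 *.
have leg : x <= x * g.+1 by rewrite leq_pmulr.
set y := K.+1 * (d.+2 * c.+1 + (4 * g + 2) * x) in le2.
(* Doubling [le2] produces this summand, at most [n], which cancels one of the two copies of [n]. *)
have eqM : 10 * (K.+1 * (d.+2 * c)) = c * M by rewrite /M mulnC; lia.
have -> : (10 * (K.+1 * (d.+2 + 4 * x)) + 16 * d.+1) * g.+1 =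
  10 * (K.+1 * (d.+2 * g.+1)) + 10 * (K.+1 * (4 * (x * g.+1))) + 16 * (d.+1 * g.+1).
  by lia.
have ey : 10 * y = 10 * (K.+1 * (d.+2 * c)) + 10 * (K.+1 * d.+2) +
   10 * (K.+1 * ((4 * g + 2) * x)) by rewrite /y; lia.
have l1 : K.+1 * d.+2 <= K.+1 * (d.+2 * g.+1) by rewrite leq_mul2l leq_pmulr.
have l2 : K.+1 * ((4 * g + 2) * x) <= K.+1 * (4 * (x * g.+1)).
  by rewrite leq_mul2l; apply/orP; right; lia.
have l3 : d.+1 <= d.+1 * g.+1 by rewrite leq_pmulr.
by lia.
Qed.
End RegionGraph.

(** * Grid subdivision of a triangulated surface *)

Section Grid.
Variables (m n : nat) (F : {set {set 'I_m}}).

(* A point of the realization, rescaled so that its largest coordinate is n,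
   lies in a product of points and open intervals between consecutive integers;
   c i = 2 k stands for the point k and c i = 2 k + 1 for the interval
   (k, k + 1). *)
Definition cell := {ffun 'I_m -> 'I_n.*2.+1}.

Definition ccoord (c : cell) (i : 'I_m) : nat := c i.

Implicit Types (c f : cell) (a i j x : 'I_m) (u : nat) (t : {set 'I_m}).

(** The interval factors of the cell, so that the cardinal is its dimension. *)
Definition odds c : {set 'I_m} := [set i | odd (ccoord c i)].

Definition grid_cell c : bool :=
  [exists t in F, [forall i, (ccoord c i != 0) ==> (i \in t)]] &&
  [exists i, ccoord c i == n.*2].

Lemma grid_cellP c : reflect
  ((exists2 t, t \in F & forall i, ccoord c i != 0 -> i \in t) /\
   exists i, ccoord c i = n.*2) (grid_cell c).
Proof.
apply: (iffP andP) => -[].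
  case/exists_inP=> t tF /forallP sub /existsP[i /eqP ci]; split; last by exists i.
  by exists t => // j cj; apply: implyP (sub j) cj.
case=> t tF sub [i ci]; split; last by apply/existsP; exists i; apply/eqP.
by apply/exists_inP; exists t => //; apply/forallP=> j; apply/implyP/sub.
Qed.

Definition upd c a u : cell := [ffun x => if x == a then inord u else c x].

Lemma updE c a u x : u <= n.*2 ->
  ccoord (upd c a u) x = if x == a then u else ccoord c x.
Proof. by move=> le; rewrite /ccoord ffunE; case: eqP => // _; rewrite inordK. Qed.

Lemma ccoord_le c i : ccoord c i <= n.*2.
Proof. by rewrite -ltnS ltn_ord. Qed.

Lemma cell_eq c c' : ccoord c =1 ccoord c' -> c = c'.
Proof. by move=> h; apply/ffunP=> i; apply: val_inj; apply: h. Qed.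

Definition dcell (k : nat) : finType :=
  {c : cell | grid_cell c && (#|odds c| == k)}.

Definition cell_of k (c : dcell k) : cell := val c.

Lemma cell_of_inj k : injective (@cell_of k).
Proof. exact: val_inj. Qed.

Lemma dcellP k (c : dcell k) :
  grid_cell (cell_of c) /\ #|odds (cell_of c)| = k.
Proof. by have /andP[? /eqP] := valP c. Qed.

Lemma dcell_exists k c : grid_cell c -> #|odds c| = k ->
  exists d : dcell k, cell_of d = c.
Proof.
move=> gc oc; have ok : grid_cell c && (#|odds c| == k) by rewrite gc oc /=.
by exists (Sub c ok).
Qed.

(* c is a codimension one face of f: the coordinate a, a point in c, becomes an
   adjacent interval in f. *)
Definition move_ok c a u : bool :=
  [&& odd u, ~~ odd (ccoord c a), u <= (ccoord c a).+1, ccoord c a <= u.+1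
    & u <= n.*2].

Definition bounds c f : bool :=
  [exists a, move_ok c a (ccoord f a) && (f == upd c a (ccoord f a))].

Lemma boundsP c f :
  reflect (exists a u, move_ok c a u /\ f = upd c a u) (bounds c f).
Proof.
apply: (iffP existsP) => [[a /andP[ok /eqP ef]]|].
  by exists a, (ccoord f a).
case=> a [u [ok ->]]; exists a.
by rewrite updE ?eqxx ?ok //=; case/and5P: ok.
Qed.

Lemma move_le c a u : move_ok c a u -> u <= n.*2.
Proof. by case/and5P. Qed.

Lemma move_cases c a u : move_ok c a u ->
  u = (ccoord c a).+1 \/ u.+1 = ccoord c a.
Proof.
case/and5P=> ou oc l1 l2 _; have : u != ccoord c a by apply: contraNneq oc => <-.
by lia.
Qed.

Lemma move_up c a : ~~ odd (ccoord c a) -> ccoord c a < n.*2 ->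
  move_ok c a (ccoord c a).+1.
Proof. by rewrite /move_ok /= => -> ->; rewrite leqnn -addn2 leq_addr. Qed.

Lemma move_down c a : ~~ odd (ccoord c a) -> 0 < ccoord c a ->
  move_ok c a (ccoord c a).-1.
Proof.
rewrite /move_ok; have := ccoord_le c a.
by case: (ccoord c a) => [//|u] /= le; rewrite negbK => -> _ /=; lia.
Qed.

Lemma odds_upd c a u : move_ok c a u -> #|odds (upd c a u)| = #|odds c|.+1.
Proof.
case/and5P=> ou oc _ _ le; have -> : odds (upd c a u) = a |: odds c.
  by apply/setP=> x; rewrite !inE updE //; case: (x =P a).
by rewrite cardsU1 inE oc.
Qed.

Lemma upd_grid_cell c a u t j : u <= n.*2 -> t \in F ->
  (forall i, ccoord c i != 0 -> i \in t) -> a \in t ->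
  j != a -> ccoord c j = n.*2 -> grid_cell (upd c a u).
Proof.
move=> le tF sub at_ ja cj; apply/grid_cellP; split.
  by exists t => // i; rewrite updE //; case: (i =P a) => [->//|_]; apply: sub.
by exists j; rewrite updE // (negPf ja).
Qed.

Lemma upd_dcell k (c : dcell k) a u t j : move_ok (cell_of c) a u -> t \in F ->
  (forall i, ccoord (cell_of c) i != 0 -> i \in t) -> a \in t ->
  j != a -> ccoord (cell_of c) j = n.*2 ->
  exists2 f : dcell k.+1, cell_of f = upd (cell_of c) a u
                        & bounds (cell_of c) (cell_of f).
Proof.
move=> ok tF sub at_ ja cj; have [_ oc] := dcellP c.
have [||f ef] := @dcell_exists k.+1 (upd (cell_of c) a u).
- exact: upd_grid_cell (move_le ok) tF sub at_ ja cj.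
- by rewrite odds_upd // oc.
by exists f => //; rewrite ef; apply/boundsP; exists a, u.
Qed.

Lemma upd_inj c a u u' : u <= n.*2 -> u' <= n.*2 ->
  upd c a u = upd c a u' -> u = u'.
Proof.
by move=> le le' /(congr1 (ccoord^~ a)); rewrite !updE // eqxx.
Qed.

Definition lower c : cell :=
  [ffun x => inord (if odd (ccoord c x) then (ccoord c x).-1 else ccoord c x)].

Definition upper c : cell :=
  [ffun x => inord (if odd (ccoord c x) then (ccoord c x).+1 else ccoord c x)].

Lemma lowerE c x :
  ccoord (lower c) x = if odd (ccoord c x) then (ccoord c x).-1 else ccoord c x.
Proof.
rewrite /ccoord ffunE inordK // ltnS -/(ccoord c x); have := ccoord_le c x.
by case: ifP => // _; apply: leq_trans (leq_pred _).
Qed.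

Lemma upperE c x :
  ccoord (upper c) x = if odd (ccoord c x) then (ccoord c x).+1 else ccoord c x.
Proof.
rewrite /ccoord ffunE inordK // ltnS -/(ccoord c x); have := ccoord_le c x.
case: ifP => // oc; rewrite leq_eqVlt => /orP[/eqP e|//].
by move: oc; rewrite e odd_double.
Qed.

Lemma max_not_odd c j : ccoord c j = n.*2 -> odd (ccoord c j) = false.
Proof. by move=> ->; rewrite odd_double. Qed.

Lemma lower_dcell k (e : dcell k) :
  exists w : dcell 0, cell_of w = lower (cell_of e).
Proof.
have [/grid_cellP[[t tF sub] [j ej]] _] := dcellP e; apply: dcell_exists.
  apply/grid_cellP; split; last by exists j; rewrite lowerE max_not_odd.
  by exists t => // i; rewrite lowerE => h; apply: sub; case: ifP h; lia.
apply/eq_card0 => i; rewrite !inE lowerE; case: ifP => //.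
by case: (ccoord _ _) => //= y /negPf.
Qed.

Lemma upper_dcell k (e : dcell k) :
  exists w : dcell 0, cell_of w = upper (cell_of e).
Proof.
have [/grid_cellP[[t tF sub] [j ej]] _] := dcellP e; apply: dcell_exists.
  apply/grid_cellP; split; last by exists j; rewrite upperE max_not_odd.
  by exists t => // i; rewrite upperE => h; apply: sub; case: ifP h; lia.
by apply/eq_card0 => i; rewrite !inE upperE; case: ifP => //= ->.
Qed.

Lemma edge_odd (e : dcell 1) : exists i, odds (cell_of e) = [set i].
Proof. by have [_ /eqP/cards1P[i]] := dcellP e; exists i. Qed.

Lemma vertex_even (w : dcell 0) i : odd (ccoord (cell_of w) i) = false.
Proof.
have [_ /eqP] := dcellP w; rewrite cards_eq0 => /eqP/setP/(_ i).
by rewrite !inE.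
Qed.

Lemma ends_bounds (e : dcell 1) (w : dcell 0) :
  (cell_of w == lower (cell_of e)) || (cell_of w == upper (cell_of e)) =
  bounds (cell_of w) (cell_of e).
Proof.
apply/idP/boundsP => [|[a [u [ok ee]]]].
  have [i ei] := edge_odd e.
  have odde x : odd (ccoord (cell_of e) x) = (x == i).
    by have /setP/(_ x) := ei; rewrite !inE.
  have oi : odd (ccoord (cell_of e) i) by rewrite odde.
  case/orP=> /eqP ->; exists i, (ccoord (cell_of e) i); split.
  - rewrite /move_ok lowerE ccoord_le oi /= andbT.
    by case: (ccoord _ _) oi => //= y -> /=; lia.
  - apply: cell_eq => x; rewrite updE ?ccoord_le // lowerE odde.
    by case: eqP => [->|].
  - by rewrite /move_ok upperE ccoord_le oi /= oi /=; lia.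
  apply: cell_eq => x; rewrite updE ?ccoord_le // upperE odde.
  by case: eqP => [->|].
have [ou _ _ _ le] := and5P ok.
have odde x : odd (ccoord (cell_of e) x) = (x == a).
  by rewrite ee updE //; case: eqP => // _; rewrite vertex_even.
apply/orP; case: (move_cases ok) => eu; [left|right];
  by apply/eqP/cell_eq => x; rewrite ?lowerE ?upperE odde ee updE //;
     case: eqP => [->|//]; rewrite eu.
Qed.

Lemma move_exists c a : 0 < n -> ~~ odd (ccoord c a) -> exists u, move_ok c a u.
Proof.
move=> n0 oc; have [lt|ge] := ltnP (ccoord c a) n.*2.
  by exists (ccoord c a).+1; apply: move_up.
exists (ccoord c a).-1; apply: move_down => //.
by apply: leq_trans ge; rewrite double_gt0.
Qed.

Lemma bounds_inv k (f : dcell k) c : bounds c (cell_of f) ->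
  exists a u t j, [/\ move_ok c a u, cell_of f = upd c a u,
    t \in F /\ (forall x, ccoord c x != 0 -> x \in t), a \in t
    & j != a /\ ccoord c j = n.*2].
Proof.
case/boundsP=> a [u [ok ef]]; have [/grid_cellP[[t tF sub] [j fj]] _] := dcellP f.
have le := move_le ok; have [ou _ _ _ _] := and5P ok.
have at_ : a \in t.
  by apply: sub; rewrite ef updE // eqxx; apply: contraTneq ou => ->.
exists a, u, t, j; split=> //.
  split=> // x cx; have [->//|xa] := eqVneq x a; apply: sub.
  by rewrite ef updE // (negPf xa).
move: fj; rewrite ef updE //; case: (j =P a) => // _ eu.
by rewrite eu odd_double in ou.
Qed.

Definition parity_step u (b : bool) : nat := if b then u.+1 else u.-1.
Arguments parity_step : simpl never.

Lemma drop_dcell k (f : dcell k.+1) a b : a \in odds (cell_of f) ->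
  let u := parity_step (ccoord (cell_of f) a) b in
  [/\ u <= n.*2, ~~ odd u &
    exists e : dcell k, cell_of e = upd (cell_of f) a u].
Proof.
rewrite inE => oa u; have le0 := ccoord_le (cell_of f) a.
have ou : ~~ odd u.
  by rewrite /u; case: (b); case: (ccoord _ _) oa => //= v; rewrite ?negbK.
have le : u <= n.*2.
  rewrite /u; case: (b) => /=; last exact: leq_trans (leq_pred _) le0.
  by rewrite ltn_neqAle le0 andbT; apply: contraTneq oa => ->; rewrite odd_double.
split=> //; have [/grid_cellP[[t tF sub] [j fj]] of_] := dcellP f.
apply: dcell_exists.
  apply: (@upd_grid_cell _ _ _ t j) => //.
    by apply: sub; apply: contraTneq oa => ->.
  by apply: contraTneq oa => <-; rewrite fj odd_double.
have : odds (cell_of f) = a |: odds (upd (cell_of f) a u).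
  by apply/setP=> x; rewrite !inE updE //; case: (x =P a) => [->|].
move/(congr1 (fun A : {set _} => #|A|)); rewrite of_ cardsU1 inE updE // eqxx ou.
by case.
Qed.

Lemma drop_bounds k (e : dcell k) (f : dcell k.+1) :
  bounds (cell_of e) (cell_of f) =
  [exists a in odds (cell_of f), exists b,
    cell_of e == upd (cell_of f) a (parity_step (ccoord (cell_of f) a) b)].
Proof.
apply/boundsP/exists_inP => [[a [u [ok ef]]]|[a af /existsP[b /eqP ee]]].
  have [ou oe _ _ le] := and5P ok; exists a; first by rewrite inE ef updE ?eqxx.
  apply/existsP; exists (u < ccoord (cell_of e) a); apply/eqP/cell_eq => x.
  have eu : parity_step u (u < ccoord (cell_of e) a) = ccoord (cell_of e) a.
    by rewrite /parity_step; case: (move_cases ok) => ->; case: ltnP => //; lia.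
  have efa : ccoord (cell_of f) a = u by rewrite ef updE ?eqxx.
  rewrite efa eu updE ?ccoord_le //; have [->//|xa] := eqVneq x a.
  by rewrite ef updE // (negPf xa).
have [le ou _] := drop_dcell b af; move: (af); rewrite inE => oa.
exists a, (ccoord (cell_of f) a); split.
  rewrite /move_ok oa ee updE // eqxx ou ccoord_le /=.
  by rewrite /parity_step; case: b {ee le ou}; lia.
apply: cell_eq => x; rewrite updE ?ccoord_le // ee updE //.
by case: eqP => [->|].
Qed.

(** A 2-cell is a product of intervals in two directions [a] and [b]. On the side [e q s] the
    coordinate [a] ([q] true) or [b] ([q] false) is fixed at its upper or lower end according to
    [s]; in [w s s'] both are fixed, [a] by [s] and [b] by [s']. *)
Lemma square_boundary (f : dcell 2) :
  exists (e : bool -> bool -> dcell 1) (w : bool -> bool -> dcell 0),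
  [/\ forall b, cell_of (w b false) = lower (cell_of (e true b)) /\
                cell_of (w b true) = upper (cell_of (e true b)),
      forall b, cell_of (w false b) = lower (cell_of (e false b)) /\
                cell_of (w true b) = upper (cell_of (e false b)),
      uniq [:: e true true; e true false; e false true; e false false]
    & forall d : dcell 1, bounds (cell_of d) (cell_of f) =
        (d \in [:: e true true; e true false; e false true; e false false])].
Proof.
have [_ /eqP/cards2P[a [b [ab of_]]]] := dcellP f.
set c := cell_of f in of_ *.
have oc x : odd (ccoord c x) = (x == a) || (x == b).
  by have /setP/(_ x) := of_; rewrite !inE.
have af : a \in odds c by rewrite of_ !inE eqxx.
have bf : b \in odds c by rewrite of_ !inE eqxx orbT.
pose p (q : bool) := if q then a else b.
have pf q : p q \in odds c by case: q.
have ex q : exists e : bool -> dcell 1, forall s,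
    cell_of (e s) = upd c (p q) (parity_step (ccoord c (p q)) s).
  have [_ _ [e1 h1]] := drop_dcell true (pf q).
  have [_ _ [e2 h2]] := drop_dcell false (pf q).
  by exists (fun s => if s then e1 else e2); case.
have [e1 h1] := ex true; have [e2 h2] := ex false.
pose e q := if q then e1 else e2.
have eE q s x : ccoord (cell_of (e q s)) x =
    if x == p q then parity_step (ccoord c (p q)) s else ccoord c x.
  have [le _ _] := drop_dcell s (pf q).
  by case: q le => le; rewrite /e ?h1 ?h2 updE.
have ab' : (b == a) = false by rewrite eq_sym (negPf ab).
pose cw s s' := upd (upd c a (parity_step (ccoord c a) s)) b
                    (parity_step (ccoord c b) s').
have [wl hl] : exists w : bool -> dcell 0, forall s,
    cell_of (w s) = lower (cell_of (e true s)).
  have [w1 ew1] := lower_dcell (e true true).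
  have [w2 ew2] := lower_dcell (e true false).
  by exists (fun s => if s then w1 else w2); case.
have [wu hu] : exists w : bool -> dcell 0, forall s,
    cell_of (w s) = upper (cell_of (e true s)).
  have [w1 ew1] := upper_dcell (e true true).
  have [w2 ew2] := upper_dcell (e true false).
  by exists (fun s => if s then w1 else w2); case.
pose w s (s' : bool) := if s' then wu s else wl s.
have [lea oa _] := drop_dcell true af; have [lea' oa' _] := drop_dcell false af.
have [leb ob _] := drop_dcell true bf; have [leb' ob' _] := drop_dcell false bf.
have ops q s : odd (parity_step (ccoord c (p q)) s) = false.
  by apply: negbTE; have [_ + _] := drop_dcell s (pf q).
have opa s := ops true s; have opb s := ops false s; rewrite /= in opa opb.
exists e, w; split.
- by move=> s; rewrite /w hl hu.
- move=> s; split; apply: cell_eq => x; rewrite ?lowerE ?upperE eE /w;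
    case: s; rewrite ?hl ?hu ?lowerE ?upperE !eE /=;
    (case: (x =P a) => [->|/eqP xa]; [rewrite (negPf ab) |
       case: (x =P b) => [->|/eqP xb]]);
    rewrite ?opa ?opb ?oc ?eqxx ?orbT ?(negPf xa) ?(negPf xb) //=.
- have neqs q : e q true != e q false.
    apply/eqP=> /(congr1 (fun d => ccoord (cell_of d) (p q))).
    by rewrite !eE eqxx /parity_step; lia.
  have neqd s s' : e true s != e false s'.
    apply/eqP=> /(congr1 (fun d => odd (ccoord (cell_of d) a))).
    by rewrite !eE eqxx /= (negPf ab) (ops true) oc eqxx.
  by rewrite cons_uniq !inE !negb_or !neqd (neqs true) /= !inE !negb_or
             (neqd false) (neqd false false) (neqs false).
move=> d; rewrite drop_bounds -/c; apply/exists_inP/idP.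
  case=> x; rewrite of_ !inE => /orP[] /eqP -> /existsP[s /eqP ed].
    have -> : d = e true s by apply: cell_of_inj; rewrite ed /e h1.
    by case: s {ed}; rewrite eqxx ?orbT.
  have -> : d = e false s by apply: cell_of_inj; rewrite ed /e h2.
  by case: s {ed}; rewrite eqxx ?orbT.
rewrite !inE => /or4P[] /eqP ->; [exists a|exists a|exists b|exists b] => //;
  apply/existsP; [exists true|exists false|exists true|exists false];
  by rewrite /e ?h1 ?h2.
Qed.

(** * The square grid on a triangulated closed surface *)

Section Surface.
Hypotheses (surfF : surface_complex F) (n_gt0 : 0 < n).

Lemma max_neq0 c j : ccoord c j = n.*2 -> ccoord c j != 0.
Proof. by move=> ->; rewrite double_eq0 -lt0n. Qed.

Lemma triangle_third t a b : t \in F -> a \in t -> b \in t -> a != b ->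
  exists k : 'I_m, [/\ k != a, k != b & t = [set a; b; k]].
Proof.
move=> tF at_ bt ab; have [_ card3 _ _ _] := surfF.
have /cards1P[k ek] : #|t :\ a :\ b| == 1.
  have := cardsD1 a t; have := cardsD1 b (t :\ a).
  by rewrite !inE eq_sym ab bt at_ (card3 t) // => ->; rewrite !add1n => -[<-].
have : k \in t :\ a :\ b by rewrite ek set11.
rewrite !inE => /and3P[kb ka kt]; exists k; split=> //.
apply/setP=> x; rewrite !inE; have [->//|xa] := eqVneq x a.
have [->//|xb] := eqVneq x b; have /setP/(_ x) := ek.
by rewrite !inE xa xb.
Qed.

Lemma triangle_edge t a b : t \in F -> a \in t -> b \in t -> a != b ->
  [set a; b] \in edges F.
Proof.
move=> tF at_ bt ab; rewrite inE cards2 ab /=; apply/exists_inP; exists t => //.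
by rewrite subUset !sub1set at_.
Qed.

Lemma dcell_eq k (d d' : dcell k) c a u :
  cell_of d = upd c a u -> cell_of d' = upd c a u -> d = d'.
Proof. by move=> h h'; apply: cell_of_inj; rewrite h. Qed.

Lemma upd_neq k (d d' : dcell k) c a a' u u' :
    move_ok c a u -> move_ok c a' u' ->
    cell_of d = upd c a u -> cell_of d' = upd c a' u' ->
  (a, u) != (a', u') -> d != d'.
Proof.
move=> ok ok' h h'; apply: contraNneq => edd; move: h'; rewrite -edd h => ee.
have aa' : a = a'.
  have := congr1 (fun c => odd (ccoord c a)) ee.
  rewrite !updE ?(move_le ok) ?(move_le ok') // eqxx.
  have [ou oc _ _ _] := and5P ok; rewrite ou.
  by case: (a =P a') => // _; rewrite (negPf oc).
rewrite -aa' in ok' ee *; apply/eqP; congr (_, _).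
exact: upd_inj (move_le ok) (move_le ok') ee.
Qed.

(** The edge runs in direction [i] with coordinate [j] maximal. If a third coordinate [k] is
    nonzero, the edge is interior to a triangle: its faces move [k] up and down, or lower [k] and
    [j] if both are maximal. Otherwise it lies on the side [ij] of the triangulation, and each of
    the two triangles there gives one face. *)
Lemma edge_two_faces (e : dcell 1) : exists f1 f2 : dcell 2, f1 != f2 /\
  forall f : dcell 2, bounds (cell_of e) (cell_of f) = (f == f1) || (f == f2).
Proof.
have [/grid_cellP[[t tF sub] [j ej]] _] := dcellP e; have [i oi] := edge_odd e.
set c := cell_of e in sub ej oi *.
have odde x : odd (ccoord c x) = (x == i) by have /setP/(_ x) := oi; rewrite !inE.
have ij : i != j.
  by apply/eqP=> ij; have := odde i; rewrite {1}ij ej odd_double eqxx.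
have ci : ccoord c i != 0.
  by apply/eqP=> c0; have := odde i; rewrite c0 eqxx.
have it : i \in t by apply: sub.
have jt : j \in t by apply/sub/max_neq0.
have evenj : ~~ odd (ccoord c j) by rewrite odde eq_sym (negPf ij).
have top x v : v \in F -> i \in v -> j \in v -> x \in v -> x != i -> x != j ->
    v = [set i; j; x].
  move=> vF iv jv xv xi xj; have [y [yi yj ev]] := triangle_third vF iv jv ij.
  by move: xv; rewrite ev !inE (negPf xi) (negPf xj) => /eqP ->.
have [/existsP[k /and3P[ki kj ck]]|no] :=
    boolP [exists k, [&& k != i, k != j & ccoord c k != 0]].
  have kt : k \in t by apply: sub.
  have evenk : ~~ odd (ccoord c k) by rewrite odde.
  have et := top k t tF it jt kt ki kj.
  have over (f : dcell 2) : bounds c (cell_of f) -> exists a u, [/\ move_ok c a u,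
      cell_of f = upd c a u & a = k \/ a = j /\ ccoord c k = n.*2].
    case/bounds_inv=> a [u [v [h [ok ef [vF subv] av [ha ch]]]]].
    exists a, u; split=> //.
    have ev : v = [set i; j; k].
      by apply: top => //; apply: subv => //; apply: max_neq0.
    have [ou oa _ _ _] := and5P ok; rewrite odde in oa.
    move: av; rewrite ev !inE (negPf oa) => /orP[/eqP aj|/eqP]; last by left.
    right; split=> //; have hv : h \in v.
      exact/subv/max_neq0.
    have hi : h != i.
      by apply/eqP=> hi; have := odde h; rewrite ch odd_double hi eqxx.
    by move: hv; rewrite ev !inE (negPf hi) -aj (negPf ha) /= => /eqP <-.
  have jk : j != k by rewrite eq_sym.
  have [ek|nek] := eqVneq (ccoord c k) n.*2.
    have ok1 : move_ok c k (ccoord c k).-1 by apply: move_down; rewrite ?lt0n.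
    have ok2 : move_ok c j (ccoord c j).-1.
      by apply: move_down; rewrite // ej double_gt0.
    have [f1 ef1 b1] := upd_dcell ok1 tF sub kt jk ej.
    have [f2 ef2 b2] := upd_dcell ok2 tF sub jt kj ek.
    exists f1, f2; split.
      by apply: (upd_neq ok1 ok2 ef1 ef2); rewrite xpair_eqE negb_and kj.
    move=> f; apply/idP/orP => [/over[a [u [ok ef ea]]]|[] /eqP -> //].
    have ca : ccoord c a = n.*2 by case: ea => [|[]] -> //; rewrite ?ek ?ej.
    have eu : u = (ccoord c a).-1.
      case: (move_cases ok) => [eu|<- //]; have := move_le ok.
      by rewrite eu ca ltnn.
    case: ea => [|[]] ea; [left|right]; apply/eqP; rewrite eu ea in ef.
      exact: dcell_eq ef ef1.
    exact: dcell_eq ef ef2.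
  have ok1 : move_ok c k (ccoord c k).+1.
    by apply: move_up; rewrite // ltn_neqAle nek ccoord_le.
  have ok2 : move_ok c k (ccoord c k).-1 by apply: move_down; rewrite ?lt0n.
  have [f1 ef1 b1] := upd_dcell ok1 tF sub kt jk ej.
  have [f2 ef2 b2] := upd_dcell ok2 tF sub kt jk ej.
  exists f1, f2; split.
    apply: (upd_neq ok1 ok2 ef1 ef2); rewrite xpair_eqE negb_and eqxx /=.
    by rewrite neq_ltn (leq_ltn_trans (leq_pred _)) // orbT.
  move=> f; apply/idP/orP => [/over[a [u [ok ef ea]]]|[] /eqP -> //].
  have {}ea : a = k by case: ea => // -[_ ek]; rewrite ek eqxx in nek.
  rewrite ea in ok ef; case: (move_cases ok) => eu; [left|right]; apply/eqP.
    by apply: dcell_eq ef1; rewrite ef eu.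
  by apply: dcell_eq ef2; rewrite ef -eu.
have c0 x : x != i -> x != j -> ccoord c x = 0.
  move=> xi xj; apply/eqP; apply: contraT => cx; case/negP: no.
  by apply/existsP; exists x; rewrite xi xj.
have [_ _ two _ _] := surfF.
have /eqP/cards2P[t1 [t2 [nt et]]] := two _ (triangle_edge tF it jt ij).
have subij (v : {set _}) : ([set i; j] \subset v) = (i \in v) && (j \in v).
  by rewrite subUset !sub1set.
have face v : v \in [set v in F | [set i; j] \subset v] -> exists k,
    [/\ k != i, k != j, v = [set i; j; k] & exists2 f : dcell 2,
      cell_of f = upd c k 1 & bounds c (cell_of f)].
  rewrite inE subij => /and3P[vF iv jv].
  have [k [ki kj ev]] := triangle_third vF iv jv ij.
  have ck := c0 k ki kj; exists k; split=> //.
  apply: (@upd_dcell 1 e k 1 v j) => //.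
  - rewrite -/c -[1](congr1 succn ck); apply: move_up; rewrite ck //.
    by rewrite double_gt0.
  - move=> x cx; have [->//|xi] := eqVneq x i; have [->//|xj] := eqVneq x j.
    by rewrite -/c c0 in cx.
  - by rewrite ev !inE eqxx !orbT.
  by rewrite eq_sym.
have [|k1 [k1i k1j et1 [f1 ef1 b1]]] := face t1; first by rewrite et !inE eqxx.
have [|k2 [k2i k2j et2 [f2 ef2 b2]]] := face t2.
  by rewrite et !inE eqxx orbT.
have k12 : k1 != k2 by apply: contraNneq nt => k12; rewrite et1 et2 k12.
have ok1 x : x != i -> x != j -> move_ok c x 1.
  move=> xi xj; rewrite -[1](congr1 succn (c0 x xi xj)).
  by apply: move_up; rewrite c0 // double_gt0.
exists f1, f2; split.
  apply: (upd_neq (ok1 _ k1i k1j) (ok1 _ k2i k2j) ef1 ef2).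
  by rewrite xpair_eqE negb_and k12.
move=> f; apply/idP/orP => [|[] /eqP -> //].
case/bounds_inv=> a [u [v [h [ok ef [vF subv] av [ha ch]]]]].
have [ou oa _ _ _] := and5P ok; rewrite odde in oa.
have hi : h != i.
  by apply/eqP=> hi; have := odde h; rewrite ch odd_double hi eqxx.
have hj : h = j.
  by apply/eqP; apply: contraT => hj; have := max_neq0 ch; rewrite c0.
have aj : a != j by rewrite -hj eq_sym.
have eu : u = 1.
  by case: (move_cases ok) => e1; rewrite ?e1 ?c0 // c0 // in e1.
have vt : v \in [set v in F | [set i; j] \subset v].
  by rewrite inE vF subij !subv // max_neq0.
rewrite et !inE in vt; case/orP: vt => /eqP vt; [left|right]; apply/eqP.
  move: av; rewrite vt et1 !inE (negPf oa) (negPf aj) /= => /eqP ak.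
  by apply: dcell_eq ef1; rewrite ef ak eu.
move: av; rewrite vt et2 !inE (negPf oa) (negPf aj) /= => /eqP ak.
by apply: dcell_eq ef2; rewrite ef ak eu.
Qed.

(** Two edges in different directions of one triangle span a square, provided that a coordinate
    other than these two is maximal and stays so. *)
Lemma face_between (w : dcell 0) (e e' : dcell 1) a u a' u' t h :
    let c := cell_of w in
    move_ok c a u -> move_ok c a' u' ->
    cell_of e = upd c a u -> cell_of e' = upd c a' u' -> a != a' ->
    t \in F -> (forall x, ccoord c x != 0 -> x \in t) -> a \in t -> a' \in t ->
    h != a -> h != a' -> ccoord c h = n.*2 ->
  exists f : dcell 2, bounds (cell_of e) (cell_of f) &&
                      bounds (cell_of e') (cell_of f).
Proof.
move=> c ok ok' ee ee' aa' tF sub at_ at' ha ha' ch.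
have le := move_le ok; have le' := move_le ok'.
have ok2 : move_ok (cell_of e) a' u'.
  by rewrite /move_ok ee updE // eq_sym (negPf aa').
have ok1 : move_ok (cell_of e') a u by rewrite /move_ok ee' updE // (negPf aa').
have [||f ef bf] := upd_dcell ok2 tF _ at' ha'.
- by move=> x; rewrite ee updE //; case: (x =P a) => [->//|_]; apply: sub.
- by rewrite ee updE // (negPf ha).
exists f; rewrite bf; apply/boundsP; exists a, u; split=> //.
rewrite ef; apply: cell_eq => x; rewrite ee ee' !updE //.
by case: (x =P a') => // ->; rewrite eq_sym (negPf aa').
Qed.

Lemma edge_at (w : dcell 0) t b h :
    let c := cell_of w in
    t \in F -> (forall x, ccoord c x != 0 -> x \in t) -> b \in t ->
    h != b -> ccoord c h = n.*2 ->
  exists (e : dcell 1) u,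
    [/\ move_ok c b u, cell_of e = upd c b u & bounds c (cell_of e)].
Proof.
move=> c tF sub bt hb ch.
have [u ok] := move_exists (c := c) (a := b) n_gt0 (negbT (vertex_even w b)).
by have [e ee be] := upd_dcell ok tF sub bt hb ch; exists e, u.
Qed.

Section Star.
Variables (w : dcell 0) (Q : dcell 1 -> bool).
Local Notation c := (cell_of w).
Hypothesis Q_face : forall e e' (f : dcell 2),
  bounds c (cell_of e) -> bounds c (cell_of e') ->
  bounds (cell_of e) (cell_of f) -> bounds (cell_of e') (cell_of f) ->
  Q e = Q e'.

Lemma star_between (e e' : dcell 1) a u a' u' t h :
    move_ok c a u -> move_ok c a' u' ->
    cell_of e = upd c a u -> cell_of e' = upd c a' u' -> a != a' ->
    t \in F -> (forall x, ccoord c x != 0 -> x \in t) -> a \in t -> a' \in t ->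
    h != a -> h != a' -> ccoord c h = n.*2 ->
  Q e = Q e'.
Proof.
move=> ok ok' ee ee' aa' tF sub at_ at' ha ha' ch.
have [f /andP[b1 b2]] := face_between ok ok' ee ee' aa' tF sub at_ at' ha ha' ch.
have be : bounds c (cell_of e) by apply/boundsP; exists a, u.
have be' : bounds c (cell_of e') by apply/boundsP; exists a', u'.
exact: Q_face be be' b1 b2.
Qed.

(** When [e] and [e'] do not span a square, pass through an edge in the third direction [k]. This
    serves for equal directions, and for the case where [a] and [a'] are maximal and [k] is not. *)
Lemma star_triangle (e e' : dcell 1) a u a' u' t j j' :
    move_ok c a u -> move_ok c a' u' ->
    cell_of e = upd c a u -> cell_of e' = upd c a' u' ->
    t \in F -> (forall x, ccoord c x != 0 -> x \in t) -> a \in t -> a' \in t ->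
    j != a -> ccoord c j = n.*2 -> j' != a' -> ccoord c j' = n.*2 ->
  Q e = Q e'.
Proof.
move=> ok ok' ee ee' tF sub at_ at' ja cj ja' cj'.
have jt : j \in t by apply/sub/max_neq0.
have jt' : j' \in t by apply/sub/max_neq0.
have [aa'|aa'] := eqVneq a a'.
  have aj : a != j by rewrite eq_sym.
  have [k [ka kj et]] := triangle_third tF at_ jt aj.
  have kt : k \in t by rewrite et !inE eqxx !orbT.
  have [|e0 [u0 [ok0 ee0 _]]] := edge_at tF sub kt _ cj; first by rewrite eq_sym.
  have jk : j != k by rewrite eq_sym.
  rewrite (star_between ok ok0 ee ee0 _ tF sub at_ kt ja jk cj) 1?eq_sym //.
  apply: (star_between ok0 ok' ee0 ee' _ tF sub kt at' jk _ cj); rewrite -aa' //.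
have [k [ka ka' et]] := triangle_third tF at_ at' aa'.
have kt : k \in t by rewrite et !inE eqxx !orbT.
have [ck|nck] := eqVneq (ccoord c k) n.*2.
  exact: (star_between ok ok' ee ee' aa' tF sub at_ at' ka ka' ck).
have {cj} ca' : ccoord c a' = n.*2.
  move: jt; rewrite et !inE (negPf ja) /= => /orP[/eqP <- //|/eqP jk].
  by rewrite -jk cj eqxx in nck.
have {cj'} ca : ccoord c a = n.*2.
  move: jt'; rewrite et !inE (negPf ja') /= orbF => /orP[/eqP <- //|/eqP jk].
  by rewrite -jk cj' eqxx in nck.
have [|e0 [u0 [ok0 ee0 _]]] := edge_at tF sub kt _ ca; first by rewrite eq_sym.
rewrite (star_between ok ok0 ee ee0 _ tF sub at_ kt _ _ ca') 1?eq_sym //.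
by apply: (star_between ok0 ok' ee0 ee' _ tF sub kt at' _ _ ca); rewrite // eq_sym.
Qed.

(** If [w] has a second nonzero coordinate [i], an edge in direction [i] lies in every triangle
    around [w] and connects them. Otherwise [w] is a vertex [j] of the triangulation, and one turns
    around it along its connected link. *)
Lemma star_linked (e e' : dcell 1) :
  bounds c (cell_of e) -> bounds c (cell_of e') -> Q e = Q e'.
Proof.
case/bounds_inv=> a [u [t [j [ok ee [tF sub] at_ [ja cj]]]]].
case/bounds_inv=> a' [u' [t' [j' [ok' ee' [tF' sub'] at' [ja' cj']]]]].
have jt : j \in t by apply/sub/max_neq0.
have jt' : j \in t' by apply/sub'/max_neq0.
have [/existsP[i /andP[ij ci]]|no] := boolP [exists i, (i != j) && (ccoord c i != 0)].
  have ji : j != i by rewrite eq_sym.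
  have [e0 [u0 [ok0 ee0 _]]] := edge_at tF sub (sub i ci) ji cj.
  rewrite (star_triangle ok ok0 ee ee0 tF sub at_ (sub i ci) ja cj ji cj).
  exact: star_triangle ok0 ok' ee0 ee' tF' sub' (sub' i ci) at' ji cj ja' cj'.
have c0 x : x != j -> ccoord c x = 0.
  move=> xj; apply/eqP; apply: contraT => cx; case/negP: no.
  by apply/existsP; exists x; rewrite xj.
have jj' : j' = j by apply: contraTeq (max_neq0 cj') => /c0 ->.
rewrite jj' in ja'; have [_ card3 _ linkF _] := surfF.
have adj_a : adjacent F j a by apply: triangle_edge tF _ _ ja.
have adj_a' : adjacent F j a' by apply: triangle_edge tF' _ _ ja'.
have /connectP[q] := linkF _ _ _ adj_a adj_a'.
elim: q a u t e ok ee tF sub at_ ja jt {adj_a} =>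
    [|y q IHq] a u t e ok ee tF sub ta ja jt /=.
  move=> _ aa'; rewrite aa' in ok' ee'.
  exact: (star_triangle ok ok' ee ee' tF sub ta ta ja cj ja cj).
case/andP=> tyF pq lq; set ty := [set j; a; y] in tyF.
have suby x : ccoord c x != 0 -> x \in ty.
  by have [->|/c0 -> //] := eqVneq x j; rewrite !inE eqxx.
have yj : j != y.
  apply/eqP=> jy; have := card3 _ tyF.
  by rewrite /ty -jy setUAC setUid cards2 ja.
have yty : y \in ty by rewrite !inE eqxx !orbT.
have aty : a \in ty by rewrite !inE eqxx !orbT.
have [e0 [u0 [ok0 ee0 _]]] := edge_at tyF suby yty yj cj.
rewrite (star_triangle ok ok0 ee ee0 tyF suby aty yty ja cj yj cj).
by apply: IHq ok0 ee0 tyF suby yty yj _ pq lq; rewrite !inE eqxx.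
Qed.
End Star.

Lemma vertex_step (w w' : dcell 0) x h :
    (forall y, y != x -> ccoord (cell_of w') y = ccoord (cell_of w) y) ->
    ccoord (cell_of w') x = (ccoord (cell_of w) x).+2 ->
    h != x -> ccoord (cell_of w) h = n.*2 ->
  exists e : dcell 1, bounds (cell_of w) (cell_of e) &&
                      bounds (cell_of w') (cell_of e).
Proof.
move=> eqw stepw hx wh.
have [/grid_cellP[[t tF sub] _] _] := dcellP w'.
have ok : move_ok (cell_of w') x (ccoord (cell_of w') x).-1.
  by apply: move_down; [rewrite vertex_even | rewrite stepw].
have xt : x \in t by apply: sub; rewrite stepw.
have wh' : ccoord (cell_of w') h = n.*2 by rewrite eqw.
have [e ee be] := upd_dcell ok tF sub xt hx wh'.
exists e; rewrite be andbT -ends_bounds; apply/orP; left; apply/eqP/cell_eq => y.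
rewrite lowerE ee updE ?(move_le ok) //; have [->|yx] := eqVneq y x.
  by rewrite stepw /= vertex_even.
by rewrite vertex_even eqw.
Qed.

Definition linked_vertices : rel (dcell 0) := [rel w w' |
  [exists e : dcell 1, bounds (cell_of w) (cell_of e) &&
                       bounds (cell_of w') (cell_of e)]].

Lemma linked_sym : symmetric linked_vertices.
Proof. by move=> w w'; apply: eq_existsb => e; rewrite andbC. Qed.

Lemma connect_zero (w : dcell 0) x h :
    h != x -> ccoord (cell_of w) h = n.*2 ->
  exists2 w' : dcell 0, connect linked_vertices w w' &
    forall y, ccoord (cell_of w') y = if y == x then 0 else ccoord (cell_of w) y.
Proof.
move=> hx; elim: (ccoord (cell_of w) x).+1 {-2}w (ltnSn (ccoord (cell_of w) x)).
  by move=> v; rewrite ltn0.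
move=> k IHk {}w lek wh; have [wx0|wx0] := eqVneq (ccoord (cell_of w) x) 0.
  by exists w => // y; case: eqP => [->|].
have wx2 : ccoord (cell_of w) x = (ccoord (cell_of w) x).-2.+2.
  by have := vertex_even w x; case: (ccoord _ _) wx0 => [|[]].
have [/grid_cellP[[t tF sub] _] even_w] := dcellP w.
have le : (ccoord (cell_of w) x).-2 <= n.*2.
  by apply: leq_trans (ccoord_le (cell_of w) x); rewrite [X in _ <= X]wx2 !leqW.
pose c := upd (cell_of w) x (ccoord (cell_of w) x).-2.
have [||v ev] := @dcell_exists 0 c.
- exact: (upd_grid_cell le tF sub (sub x wx0) hx wh).
- apply/eq_card0=> y; rewrite !inE updE //; case: eqP => _; last first.
    by rewrite vertex_even.
  by have := vertex_even w x; rewrite {1}wx2 /= negbK => ->.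
have coordv y : y != x -> ccoord (cell_of v) y = ccoord (cell_of w) y.
  by move=> yx; rewrite ev updE // (negPf yx).
have coordvx : ccoord (cell_of v) x = (ccoord (cell_of w) x).-2.
  by rewrite ev updE // eqxx.
have [||w' vw' w'E] := IHk v; first 1 last.
- by rewrite coordv.
- exists w'; last first.
    by move=> y; rewrite w'E; case: eqP => // /eqP yx; apply: coordv.
  apply: connect_trans vw'; apply: connect1; rewrite linked_sym.
  apply/existsP; apply: (@vertex_step v w x h) => //; last by rewrite coordv.
    by move=> y yx; rewrite coordv.
  by rewrite coordvx.
by rewrite coordvx; move: lek; rewrite {1}wx2 ltnS; apply: ltnW.
Qed.

Lemma connect_corner (w : dcell 0) i : ccoord (cell_of w) i = n.*2 ->
  exists2 v : dcell 0, connect linked_vertices w v &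
    forall y, ccoord (cell_of v) y = if y == i then n.*2 else 0.
Proof.
move=> wi; have [/grid_cellP[[t tF sub] _] _] := dcellP w.
have it : i \in t by apply/sub/max_neq0.
have [_ card3 _ _ _] := surfF.
have [j /setD1P[ji jt]] : exists j, j \in t :\ i.
  apply/card_gt0P; have := cardsD1 i t; rewrite it (card3 t) //.
  by rewrite add1n => -[<-].
have ij : i != j by rewrite eq_sym.
have [k [ki kj et]] := triangle_third tF it jt ij.
have ik : i != k by rewrite eq_sym.
have [w1 cw1 w1E] := connect_zero ij wi.
have w1i : ccoord (cell_of w1) i = n.*2 by rewrite w1E (negPf ij).
have [w2 cw2 w2E] := connect_zero ik w1i.
exists w2 => [|y]; first exact: connect_trans cw1 cw2.
rewrite w2E w1E; have [->|yi] := eqVneq y i; first by rewrite (negPf ij) (negPf ik).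
have [//|yk] := eqVneq y k; have [//|yj] := eqVneq y j.
apply/eqP; apply: contraT => /sub; rewrite et !inE.
by rewrite (negPf yi) (negPf yj) (negPf yk).
Qed.

(** Slide to a corner of the triangulation, then follow its edges: the point of the side [ij] where
    both coordinates are maximal is connected to both corners. *)
Lemma linked_connected (w w' : dcell 0) : connect linked_vertices w w'.
Proof.
have sym := sym_connect_sym linked_sym.
have [_ [i wi]] := grid_cellP _ (dcellP w).1.
have [_ [i' wi']] := grid_cellP _ (dcellP w').1.
have [v wv vE] := connect_corner wi; have [v' wv' v'E] := connect_corner wi'.
apply: connect_trans wv _; rewrite sym in wv'; apply: connect_trans _ wv'.
have [_ _ _ _ /(_ i i')/connectP[q]] := surfF.
elim: q i v {w wi} vE => [|j q IHq] i v vE /=.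
  move=> _ ii'; rewrite (_ : v = v') //; apply/cell_of_inj/cell_eq => y.
  by rewrite vE v'E ii'.
case/andP=> adj_ij pq lq; move: adj_ij; rewrite /adjacent inE cards2.
case/andP=> ij /exists_inP[t tF]; rewrite subUset !sub1set => /andP[it jt].
have {}ij : i != j by case: (i != j) ij.
have ji : j != i by rewrite eq_sym.
have vi : ccoord (cell_of v) i = n.*2 by rewrite vE eqxx.
have subv x : ccoord (cell_of v) x != 0 -> x \in t.
  by rewrite vE; case: (x =P i) => [->|].
have [||u eu] := @dcell_exists 0 (upd (cell_of v) j n.*2).
- exact: (upd_grid_cell (leqnn _) tF subv jt ij vi).
- apply/eq_card0=> y; rewrite !inE updE //; case: eqP => _.
    by rewrite odd_double.
  by rewrite vertex_even.
have uE y : ccoord (cell_of u) y = if (y == i) || (y == j) then n.*2 else 0.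
  by rewrite eu updE // vE; case: (y == j); rewrite ?orbT ?orbF.
have [|u1 cu1 u1E] := @connect_corner u i; first by rewrite uE eqxx.
have [|u2 cu2 u2E] := @connect_corner u j; first by rewrite uE eqxx orbT.
have u1v : u1 = v by apply/cell_of_inj/cell_eq => y; rewrite u1E vE.
rewrite u1v sym in cu1; apply: connect_trans (connect_trans cu1 cu2) _.
exact: IHq u2E pq lq.
Qed.

(** * Euler characteristic of the grid *)

Import GRing.Theory.
Local Open Scope ring_scope.

Definition supp c : {set 'I_m} := [set i | ccoord c i != 0%N].

Lemma card_dcell k : #|dcell k| = #|[set c | grid_cell c & #|odds c| == k]|.
Proof. by rewrite card_sig; apply: eq_card => c; rewrite !inE. Qed.

Lemma card_odds_le2 c : grid_cell c -> (#|odds c| <= 2)%N.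
Proof.
have [_ card3 _ _ _] := surfF.
case/grid_cellP=> -[t tF sub] [j cj]; have jt : j \in t by apply/sub/max_neq0.
have := cardsD1 j t; rewrite jt (card3 t) // add1n => -[->].
apply/subset_leq_card/subsetP=> i; rewrite !inE => oi.
rewrite sub ?andbT; last by apply: contraTneq oi => ->.
by apply: contraTneq oi => ->; rewrite cj odd_double.
Qed.

Lemma sum_sign_cells :
  \sum_(c | grid_cell c) (-1) ^+ #|odds c| =
  (#|dcell 0|%:R - #|dcell 1|%:R + #|dcell 2|%:R)%R :> int.
Proof.
have sumE k : #|dcell k|%:R = \sum_(c | grid_cell c) (#|odds c| == k)%:R :> int.
  rewrite card_dcell -sum1dep_card natr_sum big_mkcondr /=.
  by apply: eq_bigr => c _; case: (_ == k).
rewrite !sumE -sumrB -big_split /=; apply: eq_bigr => c /card_odds_le2.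
by case: #|odds c| => [|[|[|]]].
Qed.

(** The half-open interval from 0 to k has as many points as open unit intervals; for the open
    interval, in the next lemma, one point is missing. *)
Lemma sum_sign_coord k :
  \sum_(v < k.*2.+1 | v != 0%N :> nat) (-1) ^+ v = 0%R :> int.
Proof.
have e : \sum_(v < k.*2.+1) (-1) ^+ v = 1%R :> int.
  rewrite -(big_mkord xpredT (fun v => (-1) ^+ v)).
  elim: k => [|k IHk]; first by rewrite big_nat1.
  rewrite doubleS big_nat_recr // big_nat_recr //= IHk.
  by rewrite !exprS -signr_odd odd_double.
apply: (@addrI _ 1); rewrite addr0 -[RHS]e [RHS](bigD1 ord0) //=.
Qed.

Lemma sum_sign_coord_lt k : (0 < k)%N ->
  \sum_(v < k.*2.+1 | (v != 0%N :> nat) && (v != k.*2 :> nat)) (-1) ^+ v =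
  (-1)%R :> int.
Proof.
move=> k0; have := sum_sign_coord k; rewrite (bigD1 ord_max) /=; last first.
  by rewrite double_eq0 -lt0n.
rewrite -signr_odd odd_double expr0 => /eqP; rewrite addr_eq0 => /eqP e.
by apply: oppr_inj; rewrite opprK [RHS]e; congr (- _); apply: eq_bigl => v.
Qed.

Lemma sign_odds c : (-1) ^+ #|odds c| = \prod_i (-1) ^+ (c i) :> int.
Proof.
rewrite -prodr_const big_mkcond; apply: eq_bigr => i _.
by rewrite inE -[in RHS]signr_odd -/(ccoord c i); case: (odd _).
Qed.

(* The cells with support s fill a half-open cube, those of them without a
   maximal coordinate an open one. *)
Lemma sum_sign_support (s : {set 'I_m}) : s != set0 ->
  \sum_(c | (supp c == s) && [exists i, ccoord c i == n.*2]) (-1) ^+ #|odds c| =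
  (- (-1) ^+ #|s|)%R :> int.
Proof.
move=> s0.
pose A i (v : 'I_n.*2.+1) := (v != 0%N :> nat) == (i \in s).
pose B i (v : 'I_n.*2.+1) := A i v && (v != n.*2 :> nat).
have famA c : (c \in family A) = (supp c == s).
  apply/familyP/eqP => [h|e i]; last by rewrite unfold_in /A -e inE.
  by apply/setP=> i; have := h i; rewrite inE unfold_in /A => /eqP ->.
have famB c : (c \in family B) =
    (supp c == s) && ~~ [exists i, ccoord c i == n.*2].
  rewrite -famA negb_exists; apply/familyP/andP => [h|[/familyP h /forallP h'] i].
    split; [apply/familyP=> i|apply/forallP=> i];
      by have := h i; rewrite unfold_in => /andP[].
  by rewrite unfold_in; apply/andP; split; [exact: h | exact: h'].
have sumA : \sum_(c | supp c == s) (-1) ^+ #|odds c| = 0%R :> int.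
  rewrite -(eq_bigl _ _ famA) (eq_bigr _ (fun c _ => sign_odds c)).
  rewrite -(bigA_distr_big_dep _ (fun (_ : 'I_m) (v : 'I_n.*2.+1) => (-1) ^+ v)).
  have [e|[i si]] := set_0Vmem s; first by rewrite e eqxx in s0.
  rewrite (bigD1 i) //= [X in X * _](_ : _ = 0) ?mul0r //.
  by rewrite -[RHS](sum_sign_coord n); apply: eq_bigl => v; rewrite /A si eqb_id.
have sumB : \sum_(c | (supp c == s) && ~~ [exists i, ccoord c i == n.*2])
    (-1) ^+ #|odds c| = (-1) ^+ #|s| :> int.
  rewrite -(eq_bigl _ _ famB) (eq_bigr _ (fun c _ => sign_odds c)).
  rewrite -(bigA_distr_big_dep _ (fun (_ : 'I_m) (v : 'I_n.*2.+1) => (-1) ^+ v)).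
  rewrite -prodr_const [RHS]big_mkcond; apply: eq_bigr => i _.
  have [si|si] := boolP (i \in s).
    apply: etrans (sum_sign_coord_lt n_gt0); apply: eq_bigl => v.
    by rewrite /B /A si eqb_id.
  rewrite (big_pred1 ord0) //= => v; rewrite /B /A (negPf si) eqbF_neg negbK.
  apply/andP/eqP => [[/eqP v0 _]|->]; first exact: val_inj.
  by rewrite /= eq_sym double_eq0 -lt0n.
apply: (addIr (\sum_(c | (supp c == s) && ~~ [exists i, ccoord c i == n.*2])
    (-1) ^+ #|odds c|)).
by rewrite -bigID sumA sumB addNr.
Qed.

Definition simplices : {set {set 'I_m}} :=
  [set s | (s != set0) && [exists t in F, s \subset t]].

Lemma grid_cell_supp c : grid_cell c =
  (supp c \in simplices) && [exists i, ccoord c i == n.*2].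
Proof.
have [ex|] := boolP [exists i, ccoord c i == n.*2]; last first.
  by move=> /negPf ne; rewrite /grid_cell ne !andbF.
rewrite andbT inE /grid_cell ex andbT.
have -> /= : supp c != set0.
  case/existsP: ex => i /eqP ci; apply/set0Pn; exists i.
  by rewrite inE max_neq0.
apply: eq_existsb => t; congr (_ && _); apply/forallP/subsetP => h i.
  by rewrite inE => ci; apply: (implyP (h i)).
by apply/implyP=> ci; apply: h; rewrite inE.
Qed.

Lemma card_simplices :
  - (\sum_(s in simplices) (-1) ^+ #|s|)%R =
  (m%:R - #|edges F|%:R + #|F|%:R)%R :> int.
Proof.
have [[_ cover] card3 _ _ _] := surfF.
have part (P : {set {set 'I_m}}) k :
    (forall s, (s \in P) = (s \in simplices) && (#|s| == k)) ->
    #|P|%:R = \sum_(s in simplices) (#|s| == k)%:R :> int.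
  move=> hP; rewrite -sum1_card natr_sum (eq_bigl _ _ hP) big_mkcondr /=.
  by apply: eq_bigr => s _; case: (_ == k).
have e1 : m%:R = \sum_(s in simplices) (#|s| == 1%N)%:R :> int.
  rewrite -(part [set [set i] | i in 'I_m]).
    by rewrite card_imset ?card_ord //; apply: set1_inj.
  move=> s; apply/imsetP/andP => [[i _ ->]|[_ /cards1P[i ->]]]; last by exists i.
  rewrite cards1 inE; split=> //; have [t tF it] := cover i.
  rewrite -cards_eq0 cards1 /=; apply/exists_inP; exists t => //.
  by rewrite sub1set.
have e2 : #|edges F|%:R = \sum_(s in simplices) (#|s| == 2%N)%:R :> int.
  apply: part => s; rewrite !inE [in RHS]andbC andbA; congr (_ && _).
  by rewrite -cards_eq0; case: (#|s|) => [|[|[|]]].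
have e3 : #|F|%:R = \sum_(s in simplices) (#|s| == 3%N)%:R :> int.
  apply: part => s; rewrite inE; apply/idP/andP => [sF|].
    split; last by rewrite card3.
    rewrite -cards_eq0 (card3 s) //=; apply/exists_inP; exists s => //.
  case=> /andP[_ /exists_inP[t tF st]] /eqP s3.
  suff -> : s = t by [].
  by apply/eqP; rewrite eqEcard st s3 card3.
rewrite e1 e2 e3 -sumrN -sumrB -big_split /=; apply: eq_bigr => s.
rewrite inE -cards_eq0 => /andP[s0 /exists_inP[t tF st]].
have := subset_leq_card st; rewrite (card3 t) //.
by case: (#|s|) s0 => [|[|[|[|]]]].
Qed.

(** Group the cells by support: the cells inside the simplex [s] contribute [-(-1) ^+ #|s|], which
    is the contribution of [s] itself to the Euler characteristic of the triangulation. *)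
Lemma grid_euler :
  #|dcell 0|%:R - #|dcell 1|%:R + #|dcell 2|%:R = euler_char F.
Proof.
rewrite -sum_sign_cells /euler_char -!natz -card_simplices.
rewrite (partition_big supp (mem simplices)) /= => [|c]; last first.
  by rewrite grid_cell_supp => /andP[].
rewrite -sumrN; apply: eq_bigr => s ss; rewrite -sum_sign_support; last first.
  by move: ss; rewrite inE => /andP[].
apply: eq_bigl => c; rewrite grid_cell_supp andbC.
by case: eqP => //= ->; rewrite ss.
Qed.
Local Close Scope ring_scope.

Lemma grid_surface g : euler_char F = (2 - 2 * g%:Z)%R ->
  exists (s t : dcell 1 -> dcell 0) (l r : dcell 1 -> dcell 2),
  [/\ cell_surface s t l r,
      #|dcell 1| + 2 = #|dcell 0| + #|dcell 2| + 2 * g,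
      forall f : dcell 2, #|[set e | incident l r e f]| <= 4
    & forall w w', w != w' -> linked_vertices w w' -> joined s t setT w w'].
Proof.
move=> chi.
have /fin_all_exists[s sE] := @lower_dcell 1.
have /fin_all_exists[t tE] := @upper_dcell 1.
have /fin_all_exists[l /fin_all_exists[r lrP]] := edge_two_faces.
have st_bounds e w : incident s t e w = bounds (cell_of w) (cell_of e).
  rewrite -ends_bounds /incident -!(inj_eq (@cell_of_inj 0)) sE tE.
  by rewrite eq_sym [X in _ || X]eq_sym.
have lr_bounds e (f : dcell 2) : incident l r e f = bounds (cell_of e) (cell_of f).
  by rewrite (lrP e).2 /incident eq_sym [X in _ || X]eq_sym.
have link_joined w w' : w != w' -> linked_vertices w w' -> joined s t setT w w'.
  move=> ww' /existsP[e]; rewrite -!st_bounds /incident => /andP[we we'].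
  apply/exists_inP; exists e => //.
  move: ww'; case/orP: we => /eqP <-; case/orP: we' => /eqP <-;
    by rewrite !eqxx ?orbT.
exists s, t, l, r; split=> //.
- split=> [e|D f|P w side e e' ew ew'|w w'|].
  + by have [] := lrP e.
  + have [e [w [w1 w2 ue fE]]] := square_boundary f.
    have setE : [set d | incident l r d f] =
        [set d in [:: e true true; e true false; e false true; e false false]].
      by apply/setP=> d; rewrite !inE lr_bounds fE !inE.
    pose cut d := (s d \in D) != (t d \in D).
    have -> : [set d | cut d && incident l r d f] =
        [set d in [seq d <- [:: e true true; e true false; e false true;
                                e false false] | cut d]].
      by apply/setP=> d; rewrite inE [RHS]inE mem_filter lr_bounds fE.
    rewrite cardsE (card_uniqP (filter_uniq _ ue)) size_filter.
    have s1 b : s (e true b) = w b false by apply: cell_of_inj; rewrite sE (w1 b).1.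
    have t1 b : t (e true b) = w b true by apply: cell_of_inj; rewrite tE (w1 b).2.
    have s2 b : s (e false b) = w false b by apply: cell_of_inj; rewrite sE (w2 b).1.
    have t2 b : t (e false b) = w true b by apply: cell_of_inj; rewrite tE (w2 b).2.
    (* Going around the four corners, membership in [D] changes an even number of times. *)
    rewrite /= /cut !s1 !t1 !s2 !t2.
    by case: (w true true \in D); case: (w true false \in D);
       case: (w false true \in D); case: (w false false \in D).
  + apply: (@star_linked w (fun d => l d \in P)); rewrite -?st_bounds //.
    move=> d d' f wd wd' df d'f.
    have inP d0 : bounds (cell_of w) (cell_of d0) ->
        bounds (cell_of d0) (cell_of f) -> (l d0 \in P) = (f \in P).
      rewrite -st_bounds -lr_bounds => /side.
      by move=> eq_lr /orP[] /eqP <-.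
    by rewrite (inP d) // (inP d').
  + apply: connect_sub (linked_connected w w') => x y xy.
    have [->|nxy] := eqVneq x y; first exact: connect0.
    exact/connect1/link_joined.
  split=> [w|f].
    have [/grid_cellP[[v vF sub] [j wj]] _] := dcellP w.
    have jv : j \in v by apply/sub/max_neq0.
    have [_ card3 _ _ _] := surfF.
    have [k /setD1P[kj kv]] : exists k, k \in v :\ j.
      apply/card_gt0P; have := cardsD1 j v; rewrite jv (card3 v) //.
      by rewrite add1n => -[<-].
    have [|e [u [_ _ be]]] := edge_at vF sub kv _ wj; first by rewrite eq_sym.
    by exists e; rewrite st_bounds.
  have [e [w [_ _ _ fE]]] := square_boundary f.
  by exists (e true true); rewrite lr_bounds fE inE eqxx.
- have := grid_euler; rewrite chi; lia.
move=> f; have [e [w [_ _ _ fE]]] := square_boundary f.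
apply: leq_trans (_ : size [:: e true true; e true false;
                               e false true; e false false] <= 4).
  apply: leq_trans (card_size _); apply/subset_leq_card/subsetP=> d.
  by rewrite inE lr_bounds fE.
by [].
Qed.
End Surface.
End Grid.

From mathcomp Require Import all_classical all_reals all_analysis.

Import Order.TTheory GRing.Theory Num.Theory.
Import numFieldNormedType.Exports.

Local Open Scope classical_set_scope.
Local Open Scope ring_scope.

(** * Topological embeddings *)

Section Geometry.
Variables (R : realType) (m n : nat) (F : {set {set 'I_m}}).

(** The radial projection of the realization to the unit sphere of the maximum norm: each triangle
    becomes three faces of a cube, which the coordinate grid cuts into squares. *)
Definition scaled_realization : set 'rV[R]_m :=
  [set z | [/\ forall i, 0 <= z ord0 i <= 1, exists i, z ord0 i = 1
             & exists2 t, t \in F & forall i, i \notin t -> z ord0 i = 0]].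

(** For a grid vertex [c] this is less than one mesh width in every coordinate. Strictness makes the
    condition open and forces a coordinate 0 or 1 of [z] on the even coordinates of [c]. *)
Definition near_cell (z : 'rV[R]_m) (c : cell m n) : Prop :=
  forall i, `|n.*2%:R * z ord0 i - (ccoord c i)%:R| < 2.

Definition near_vertices (A : set 'rV[R]_m) : {set dcell n F 0} :=
  [set w | `[< exists2 z, A z & near_cell z (cell_of w) >]]%SET.

Lemma near_verticesP A w :
  (w \in near_vertices A) <-> (exists2 z, A z & near_cell z (cell_of w)).
Proof. by rewrite inE; split => /asboolP. Qed.

Lemma near_cell_max z c j : near_cell z c -> ~~ odd (ccoord c j) ->
  z ord0 j = 1 -> ccoord c j = n.*2.
Proof.
move=> zc oc zj; have := zc j; rewrite zj mulr1.
rewrite -natrB ?ccoord_le // normr_nat ltr_nat => lt.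
have := ccoord_le c j; have : ~~ odd (n.*2 - ccoord c j).
  by rewrite oddB ?ccoord_le // odd_double.
move: lt; case e: (n.*2 - ccoord c j)%N => [|[|k]] // _ _.
by move/eqP: e; rewrite subn_eq0 => l1 l2; apply/eqP; rewrite eqn_leq l1 l2.
Qed.

Lemma near_cell_zero z c j : near_cell z c -> ~~ odd (ccoord c j) ->
  z ord0 j = 0 -> ccoord c j = 0%N.
Proof.
move=> zc oc zj; have := zc j; rewrite zj mulr0 sub0r normrN normr_nat ltr_nat.
by case: (ccoord c j) oc => [|[|k]].
Qed.

Lemma near_dcell z c : scaled_realization z -> near_cell z c ->
  (forall i, ~~ odd (ccoord c i)) -> exists w : dcell n F 0, cell_of w = c.
Proof.
move=> [_ [j zj] [t tF zt]] zc ec; apply: dcell_exists; last first.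
  by apply/eq_card0=> i; rewrite !inE (negPf (ec i)).
apply/grid_cellP; split; last by exists j; apply: (near_cell_max zc).
exists t => // i; apply: contraNT => it; apply/eqP.
by apply: (near_cell_zero zc) => //; apply: zt.
Qed.

Lemma near_exists z : scaled_realization z ->
  exists w : dcell n F 0, near_cell z (cell_of w).
Proof.
move=> zR; have [zb _ _] := zR.
pose a i := Num.truncn (n%:R * z ord0 i).
have nz0 i : 0 <= n%:R * z ord0 i by rewrite mulr_ge0 ?ler0n; case/andP: (zb i).
have an i : (a i <= n)%N.
  have le : (a i)%:R <= n%:R * z ord0 i by rewrite truncn_le.
  rewrite -(ler_nat R) (le_trans le) //.
  by rewrite -[leRHS]mulr1 ler_wpM2l //; case/andP: (zb i).
pose c : cell m n := [ffun i => inord (a i).*2].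
have cE i : ccoord c i = (a i).*2.
  by rewrite /ccoord ffunE inordK // ltnS leq_double an.
have zc : near_cell z c.
  move=> i; rewrite cE -!muln2 !natrM.
  have := truncn_itv (nz0 i); rewrite -/(a i) => /andP[l1 l2].
  rewrite -natr1 in l2; rewrite ltr_norml; lra.
have [|w ew] := near_dcell zR zc; first by move=> i; rewrite cE odd_double.
by exists w; rewrite ew.
Qed.

(** Grid vertices near one point differ by at most one step in each coordinate, so the coordinates
    are corrected one at a time. A coordinate [h] with value 1 at [z] is maximal in all of them,
    which keeps the intermediate points in the grid. *)
Lemma near_linked z (w w' : dcell n F 0) : scaled_realization z ->
  near_cell z (cell_of w) -> near_cell z (cell_of w') ->
  connect (inside (@linked_vertices m n F) (near_vertices [set z])) w w'.
Proof.
move=> zR zw zw'.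
pose diff (w : dcell n F 0) :=
  [set i | ccoord (cell_of w) i != ccoord (cell_of w') i]%SET.
elim: #|diff w|.+1 {-2}w (ltnSn #|diff w|) zw => // k IHk {}w ltk zw.
have [d0|[i]] := set_0Vmem (diff w).
  rewrite (_ : w = w') ?connect0 //; apply/cell_of_inj/cell_eq => i.
  by apply/eqP; have /finset.setP/(_ i) := d0; rewrite !inE => /negbFE.
rewrite inE => wi.
pose c := upd (cell_of w) i (ccoord (cell_of w') i).
have cE x : ccoord c x =
    if x == i then ccoord (cell_of w') i else ccoord (cell_of w) x.
  by rewrite updE // ccoord_le.
have zc : near_cell z c by move=> x; rewrite cE; case: eqP => [->|].
have [|v ev] := near_dcell zR zc.
  by move=> x; rewrite cE; case: eqP => _; rewrite vertex_even.
have zv : near_cell z (cell_of v) by rewrite ev.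
have memz (u : dcell n F 0) : near_cell z (cell_of u) -> u \in near_vertices [set z].
  by move=> zu; apply/near_verticesP; exists z.
apply: (@connect_trans _ _ v); last first.
  apply: IHk => //; rewrite -ltnS; apply: leq_trans ltk; apply: proper_card.
  apply/properP; split.
    by apply/fintype.subsetP=> x; rewrite !inE ev cE;
       case: (x =P i) => // ->; rewrite eqxx.
  by exists i; rewrite !inE ?ev ?cE ?eqxx.
apply: connect1; rewrite /inside /= !memz //=.
have [_ [h zh] _] := zR.
have wh := near_cell_max zw (negbT (vertex_even w h)) zh.
have wh' := near_cell_max zw' (negbT (vertex_even w' h)) zh.
have hi : h != i by apply: contraNneq wi => <-; rewrite wh wh'.
have vE x : ccoord (cell_of v) x =
    if x == i then ccoord (cell_of w') i else ccoord (cell_of w) x.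
  by rewrite ev cE.
have vi : ccoord (cell_of v) i = ccoord (cell_of w') i by rewrite vE eqxx.
have step : ccoord (cell_of v) i = (ccoord (cell_of w) i).+2 \/
            ccoord (cell_of w) i = (ccoord (cell_of v) i).+2.
  have even_half k' : odd k' = false -> k' = k'./2.*2.
    by move=> ok; rewrite -{1}[k']odd_double_half ok.
  have := even_half _ (vertex_even w i); have := even_half _ (vertex_even v i).
  have : ccoord (cell_of v) i != ccoord (cell_of w) i by rewrite vi eq_sym.
  have lt4 (x y : nat) (u : R) : `|u - x%:R| < 2 -> `|u - y%:R| < 2 -> (x < y + 4)%N.
    rewrite !ltr_norml -(ltr_nat R) natrD; lra.
  have := lt4 _ _ _ (zw i) (zv i); have := lt4 _ _ _ (zv i) (zw i).
  move: (ccoord _ _) (ccoord _ _) => x y; clear; lia.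
case: step => st; last rewrite linked_sym; apply/existsP;
  apply: (vertex_step (x := i) (h := h)) => //.
- by move=> y yi; rewrite vE (negPf yi).
- by move=> y yi; rewrite vE (negPf yi).
by rewrite vE (negPf hi).
Qed.

Lemma open_near_cell c : open [set z | near_cell z c].
Proof.
rewrite openE => z zc.
apply: (@filter_forall _ _ (fun i (y : 'rV[R]_m) =>
  `|n.*2%:R * y ord0 i - (ccoord c i)%:R| < 2) (nbhs z)) => i.
have cont : (fun y : 'rV[R]_m => `|n.*2%:R * y ord0 i - (ccoord c i)%:R|) @ z -->
    `|n.*2%:R * z ord0 i - (ccoord c i)%:R|.
  have h1 : (fun y : 'rV[R]_m => y ord0 i) @ z --> z ord0 i :=
    @coord_continuous R _ _ _ _ z.
  have h2 : (fun y : 'rV[R]_m => n.*2%:R * y ord0 i) @ z --> n.*2%:R * z ord0 i.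
    exact: cvgM (cvg_cst _) h1.
  exact: cvg_norm (cvgB h2 (cvg_cst _)).
exact: (cvgr_lt _ cont _ (zc i)).
Qed.

(** The open stars of the grid vertices cover [A]. If some near vertex were not reachable from [x],
    the stars of reachable and of unreachable ones would split [A]; they are disjoint on [A] by
    [near_linked]. *)
Lemma near_vertices_connected (A : set 'rV[R]_m) :
    connected A -> A `<=` scaled_realization ->
  forall x y, x \in near_vertices A -> y \in near_vertices A ->
    connect (inside (@linked_vertices m n F) (near_vertices A)) x y.
Proof.
move=> connA AR x y xA yA; set e := inside _ _.
pose U (P : pred (dcell n F 0)) :=
  \bigcup_(w in [set w | P w]) [set z | near_cell z (cell_of w)].
have openU P : open (U P) by apply: bigcup_open => w _; apply: open_near_cell.
pose P w := (w \in near_vertices A) && connect e x w.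
pose P' w := (w \in near_vertices A) && ~~ connect e x w.
have disj z : A z -> U P z -> U P' z -> False.
  move=> Az [w /andP[wA xw] zw] [w' /andP[wA' xw'] zw'].
  case/negP: xw'; apply: connect_trans xw _.
  have sub : near_vertices [set z] \subset near_vertices A.
    apply/fintype.subsetP=> v /near_verticesP[_ -> zv].
    by apply/near_verticesP; exists z.
  apply: connect_sub (near_linked (AR z Az) zw zw') => u v /and3P[uz vz uv].
  by apply: connect1; rewrite /e /inside /= !(fintype.subsetP sub).
have coverU z : A z -> U P z \/ U P' z.
  move=> Az; have [w zw] := near_exists (AR z Az).
  have wA : w \in near_vertices A by apply/near_verticesP; exists z.
  by case xw: (connect e x w); [left|right]; exists w; rewrite //= /P /P' wA xw.
have eqA : A `&` U P = A.
  apply: connA.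
  - have /near_verticesP[z Az zx] := xA; exists z; split=> //.
    by exists x; rewrite //= /P xA connect0.
  - by exists (U P).
  exists (~` U P'); first exact: open_closedC.
  apply/seteqP; split=> z [Az]; first by move=> zP; split=> // /(disj z Az zP).
  by move=> zP'; split=> //; case: (coverU z Az).
have /near_verticesP[z Az zy] := yA.
have [w /andP[wA xw] zw] : U P z by move: Az; rewrite -eqA => -[].
apply: contraT => xy; case: (disj z Az); last by exists y; rewrite //= /P' yA xy.
by exists w; rewrite //= /P wA xw.
Qed.
End Geometry.

(** * Separation of compact sets, and the radial projection *)

Section Embedding.
Variable R : realType.

Lemma compact_separated m (A B : set 'rV[R]_m) : compact A -> compact B ->
    A `&` B = set0 ->
  exists2 delta : R, 0 < delta & forall a b, A a -> B b -> delta <= `|a - b|.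
Proof.
move=> cA cB AB.
have [[p0 AB0]|ne] := pselect (A `*` B !=set0); last first.
  by exists 1 => // a b Aa Bb; case: ne; exists (a, b).
pose f (p : 'rV[R]_m * 'rV[R]_m) : R := `|p.1 - p.2|.
have contf : {within A `*` B, continuous f}.
  apply: continuous_subspaceT => p.
  exact: cvg_norm (cvgB cvg_fst cvg_snd).
have [p pAB pmin] :=
  compact_EVT_min (ex_intro _ p0 AB0) (compact_setX cA cB) contf.
have [Ap Bp] := set_mem pAB.
exists (f p); last by move=> a b Aa Bb; apply: (pmin (a, b)); apply: mem_set.
rewrite normr_gt0 subr_eq0; apply/eqP=> e.
have : (A `&` B) p.1 by split=> //; rewrite e.
by rewrite AB.
Qed.

Lemma compact_family_separated m (V : finType) (A : V -> set 'rV[R]_m) :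
    (forall v, compact (A v)) ->
  exists2 delta : R, 0 < delta & forall u v a b, A u a -> A v b ->
    `|a - b| < delta -> A u `&` A v !=set0.
Proof.
move=> cA.
have sep (p : V * V) : exists delta : R, 0 < delta /\
    forall a b, A p.1 a -> A p.2 b -> `|a - b| < delta -> A p.1 `&` A p.2 !=set0.
  have [ne|/set0P/negP/negbNE/eqP e] := pselect (A p.1 `&` A p.2 !=set0).
    by exists 1.
  have [delta d0 dP] := compact_separated (cA _) (cA _) e.
  by exists delta; split=> // a b Aa Bb; rewrite ltNge dP.
have /fin_all_exists[delta dP] := sep.
exists (\big[Order.min/1]_p delta p).
  elim/big_ind: _ => // [x y x0 y0|p _]; last by have [] := dP p.
  by rewrite lt_min x0.
move=> u v a b ua vb lt; have [_ /(_ a b ua vb)] := dP (u, v); apply.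
by apply: lt_le_trans lt _; apply: bigmin_le_cond.
Qed.

Definition scale_max m (x : 'rV[R]_m) : 'rV[R]_m := `|x|^-1 *: x.

Lemma coord_le_norm m (x : 'rV[R]_m) i : `|x ord0 i| <= `|x|.
Proof.
rewrite -[leRHS]/(mx_norm x) mx_normrE.
by apply/bigmax_geP; right; exists (ord0, i).
Qed.

Lemma norm_lt_coord m (x : 'rV[R]_m) d : 0 < d ->
  (forall i, `|x ord0 i| < d) -> `|x| < d.
Proof.
move=> d0 h; rewrite -[ltLHS]/(mx_norm x) mx_normrE; apply/bigmax_ltP.
split=> // -[i j] _ /=.
by rewrite ord1 h.
Qed.

Section Realization.
Variables (m : nat) (F : {set {set 'I_m}}).

Lemma realization_neq0 (x : 'rV[R]_m) : realization F R x -> x != 0.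
Proof.
case=> _ sx _; apply/eqP=> x0; move/eqP: sx.
by rewrite big1 ?(eq_sym 0) ?oner_eq0 // => i _; rewrite x0 mxE.
Qed.

Lemma scale_max_realization (x : 'rV[R]_m) : realization F R x ->
  scaled_realization F (scale_max x).
Proof.
move=> rx; have x0 := realization_neq0 rx; have [xp sx [t tF xt]] := rx.
have nx : 0 < `|x| by rewrite normr_gt0.
split.
- move=> i; rewrite mxE mulr_ge0 ?invr_ge0 //= ler_pdivrMl // mulr1.
  by apply: le_trans (coord_le_norm x i); apply: ler_norm.
- have [|[i j] e] := @mx_norm_neq0 R 1 m x; first exact: (lt0r_neq0 nx).
  exists j; move: e; rewrite /= ord1 => e; rewrite mxE.
  have {}e : `|x| = x ord0 j by rewrite [LHS]e ger0_norm.
  by rewrite e mulVf // -e gt_eqF.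
by exists t => // i it; rewrite mxE xt // mulr0.
Qed.

Lemma scale_max_inj (x y : 'rV[R]_m) : realization F R x -> realization F R y ->
  scale_max x = scale_max y -> x = y.
Proof.
move=> rx ry e; have [_ sx _] := rx; have [_ sy _] := ry.
have sumE (z : 'rV[R]_m) : \sum_v z ord0 v = 1 ->
    \sum_v (scale_max z) ord0 v = `|z|^-1.
  by move=> sz; under eq_bigr do rewrite mxE; rewrite -mulr_sumr sz mulr1.
have nxy : `|x| = `|y| by apply: invr_inj; rewrite -sumE // -(sumE y) // e.
have ny : `|y|^-1 != 0 by rewrite invr_eq0 normr_eq0 (realization_neq0 ry).
by apply: (scalerI ny); rewrite -[in LHS]nxy.
Qed.

Lemma scale_max_continuous (x : 'rV[R]_m) : x != 0 ->
  {for x, continuous (@scale_max m)}.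
Proof.
move=> x0.
have h1 : (fun y : 'rV[R]_m => `|y|) @ x --> `|x| by exact: cvg_norm cvg_id.
have nx : `|x| != 0 by rewrite normr_eq0.
have h2 : (fun y : 'rV[R]_m => `|y|^-1) @ x --> `|x|^-1 by exact: cvgV nx h1.
exact: (cvgZ h2 cvg_id).
Qed.
End Realization.
End Embedding.

(** * Half-stars of an embedded graph as regions *)

Section Drawing.
Variables (R : realType) (G : graph) (m : nat) (F : {set {set 'I_m}}).
Variables (y : gvertex G -> 'rV[R]_m) (eta : gedge G -> R -> 'rV[R]_m).
Hypotheses (y_inj : injective y)
  (eta_cont : forall e, {within `[0, 1], continuous (eta e)})
  (eta_ends : forall e, eta e 0 = y (gsrc e) /\ eta e 1 = y (gtgt e))
  (eta_vertex : forall e (s : R) v, 0 < s < 1 -> eta e s <> y v)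
  (eta_inj : forall e e' (s s' : R), 0 < s < 1 -> 0 < s' < 1 ->
     eta e s = eta e' s' -> e = e' /\ s = s').

Definition graph_adj : rel (gvertex G) :=
  joined (@gsrc G) (@gtgt G) [set: gedge G]%SET.

(* The half-edges, and a vertex itself as None. *)
Definition branch (o : option (gedge G * bool)) : set R :=
  match o with
  | Some (e, false) => `[0, 2^-1]
  | Some (e, true) => `[2^-1, 1]
  | None => set0
  end.

Definition branch_of (v : gvertex G) : {pred option (gedge G * bool)} :=
  fun o => match o with
  | Some (e, b) => (if b then gtgt e else gsrc e) == v
  | None => true
  end.

Definition branch_image (v : gvertex G) (o : option (gedge G * bool)) :
    set 'rV[R]_m :=
  match o with
  | Some (e, b) => eta e @` branch o
  | None => [set y v]
  end.

(** Cutting edges at their midpoints makes half-stars of distinct vertices meet exactly when the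
    vertices are adjacent. The vertex itself is included for the sake of isolated vertices. *)
Definition half_star (v : gvertex G) : set 'rV[R]_m :=
  \bigcup_(o in [set` branch_of v]) branch_image v o.

Lemma branch_sub o : branch o `<=` `[0, 1].
Proof.
case: o => [[e []]|] // s /=; rewrite !in_itv /= => /andP[h1 h2];
  apply/andP; split; lra.
Qed.

Lemma half_star_compact v : compact (half_star v).
Proof.
rewrite /half_star bigcup_pred; apply: bigsetU_compact => o _.
case: o => [[e b]|]; last exact: compact_set1.
apply: continuous_compact; last by case: b; exact: segment_compact.
exact: (continuous_subspaceW (@branch_sub (Some (e, b))) (@eta_cont e)).
Qed.

Lemma half_star_connected v : connected (half_star v).
Proof.
apply: bigcup_connected.
  exists (y v) => -[[e b]|] //= /eqP <-; have [e0 e1] := eta_ends e.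
  case: b; [exists 1 | exists 0]; rewrite //= in_itv /=; lra.
move=> [[e b]|] _; last exact: connected1.
apply: connected_continuous_connected.
  by case: b; exact: segment_connected.
exact: (continuous_subspaceW (@branch_sub (Some (e, b))) (@eta_cont e)).
Qed.

Lemma half_star_mem v z : half_star v z -> z = y v \/
  exists e (s : R), z = eta e s /\
    ((gsrc e = v /\ 0 <= s <= 2^-1) \/ (gtgt e = v /\ 2^-1 <= s <= 1)).
Proof.
case=> -[[e []]|] /=; last by left.
- by move=> /eqP ev [s /=]; rewrite in_itv /= => sb <-; right; exists e, s; auto.
- by move=> /eqP ev [s /=]; rewrite in_itv /= => sb <-; right; exists e, s; auto.
Qed.

Lemma half_star_cases v z : half_star v z -> z = y v \/
  exists e (s : R), [/\ z = eta e s, 0 < s < 1 &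
    ((gsrc e = v /\ s <= 2^-1) \/ (gtgt e = v /\ 2^-1 <= s))].
Proof.
case/half_star_mem=> [|[e [s [-> h]]]]; first by left.
have [e0 e1] := eta_ends e.
case: h => -[ev /andP[s1 s2]].
  have [s0|s0] := eqVneq s 0; first by left; rewrite s0 e0 ev.
  right; exists e, s; split=> //; last by left.
  by rewrite lt_neqAle eq_sym s0 s1 /=; lra.
have [s0|s0] := eqVneq s 1; first by left; rewrite s0 e1 ev.
right; exists e, s; split=> //; last by right.
by apply/andP; split; [lra | rewrite lt_neqAle s0].
Qed.

Lemma half_star_meet u v : half_star u `&` half_star v !=set0 ->
  u = v \/ graph_adj u v.
Proof.
case=> z [/half_star_cases zu /half_star_cases zv].
case: zu zv => [->|[e [s [-> s01 h]]]] [].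
- by move/y_inj; left.
- by case=> e [s [eq_y s01 _]]; case: (@eta_vertex e s u s01).
- by move=> eq_y; case: (@eta_vertex e s v s01).
case=> e' [s' [eq_eta s01' h']].
have [ee' ss'] := eta_inj s01 s01' eq_eta; rewrite -{}ee' -{}ss' in h'.
have adj_e : (gsrc e = u /\ gtgt e = v) \/ (gsrc e = v /\ gtgt e = u) ->
    graph_adj u v.
  by case=> -[<- <-]; apply/exists_inP; exists e; rewrite ?eqxx ?orbT.
by case: h h' => -[eu hs] [] [ev hs']; [left; rewrite -eu | right; apply: adj_e; auto
  | right; apply: adj_e; auto | left; rewrite -eu].
Qed.

Lemma half_star_adj u v : graph_adj u v -> half_star u `&` half_star v !=set0.
Proof.
case/exists_inP=> e _ he.
have mid w : gsrc e = w \/ gtgt e = w -> half_star w (eta e 2^-1).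
  case=> ew; [exists (Some (e, false)) | exists (Some (e, true))];
    rewrite /= ?ew //; try exact/eqP;
    by exists 2^-1; rewrite //= in_itv /=; lra.
exists (eta e 2^-1); case/orP: he => /andP[/eqP e1 /eqP e2]; split; apply: mid; auto.
Qed.

Hypotheses (y_in : forall v, scaled_realization F (y v))
  (eta_in : forall e (s : R), 0 <= s <= 1 -> scaled_realization F (eta e s)).

Lemma half_star_in v : half_star v `<=` scaled_realization F.
Proof.
move=> z /half_star_mem[->//|[e [s [-> h]]]]; apply: eta_in.
by case: h => -[_ /andP[]] h1 h2; apply/andP; split; lra.
Qed.

Lemma drawing_bound d K g :
    surface_complex F -> euler_char F = 2 - 2 * g%:Z ->
    (forall v : gvertex G, (#|[set u | graph_adj v u]%SET| <= d)%N) ->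
    vertex_expander graph_adj K -> (0 < K)%N -> (0 < nb_vertices G)%N ->
  (nb_vertices G <= region_constant d K * g.+1)%N.
Proof.
move=> surfF chi deg exp K0 V0.
have [delta delta0 sep] := compact_family_separated half_star_compact.
(* Two points near a common grid vertex are less than 2 / n apart, hence less than [delta], so their
   half-stars meet. *)
pose n := (Num.truncn (2 / delta)).+1.
have ltn : 2 / delta < n%:R by apply: truncnS_gt.
have n0 : (0 < n)%N by [].
have [s [t [l [r [surf euler face4 lj]]]]] := grid_surface surfF n0 chi.
apply: (region_graph_bound (adj := graph_adj)
  (S := fun v => near_vertices n F (half_star v))) surf euler face4 _ _ _ _ => //.
- exact: joined_sym.
- move=> v x w xS wS.
  have := near_vertices_connected (half_star_connected (v := v))
    (@half_star_in v) xS wS.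
  apply: connect_sub => a b /and3P[aS bS ab].
  have [->|nab] := eqVneq a b; first exact: connect0.
  by apply: connect1; rewrite /inside /= aS bS lj.
- move=> v; have [w yw] := near_exists n (y_in v).
  by exists w; apply/near_verticesP; exists (y v) => //; exists None.
- move=> u v /half_star_adj[z [zu zv]].
  have [w zw] := near_exists n (half_star_in zu).
  by exists w; apply/near_verticesP; exists z.
move=> u v w /near_verticesP[z zu zw] /near_verticesP[z' zv zw'].
apply: half_star_meet; apply: (sep _ _ _ _ zu zv).
apply: norm_lt_coord => // i.
have := zw i; have := zw' i; rewrite !mxE.
rewrite -muln2 natrM; move: (ccoord _ _)%:R => c h1 h2.
have {}ltn : 2 < n%:R * delta by rewrite -ltr_pdivrMr.
have np : 0 < n%:R :> R by rewrite ltr0n.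
have : `|n%:R * (z ord0 i - z' ord0 i)| < n%:R * delta.
  by move: h1 h2; rewrite !ltr_norml; lra.
by rewrite normrM gtr0_norm // ltr_pM2l.
Qed.
End Drawing.

(** * From edge expansion to the genus *)

Section Genus.
Variable R : realType.

Lemma embedding_bound (G : graph) (S : topologicalType) d K g :
    orientable_of_genus R S g -> embeds R G S ->
    (forall v : gvertex G, (#|[set u | graph_adj v u]%SET| <= d)%N) ->
    vertex_expander (@graph_adj G) K -> (0 < K)%N -> (0 < nb_vertices G)%N ->
  (nb_vertices G <= region_constant d K * g.+1)%N.
Proof.
case=> m [F [surfF [f [f' [[cf _] fP _]] _ chi]]].
case=> p [gamma [p_inj gamma_cont gamma_ends gamma_vertex gamma_inj]].
have fR x : realization F R (f x) by apply: (fP x _).1.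
have scf_inj : injective (fun x => scale_max (f x)).
  move=> x x' /(scale_max_inj (fR x) (fR x')) e.
  by rewrite -(fP x _).2 // e (fP x' _).2.
have scf_cont : continuous (fun x => scale_max (f x)).
  move=> x; apply: (continuous_comp (f := f) (g := @scale_max R m)).
    exact: ((continuous_subspace_setT f).2 cf x).
  exact/scale_max_continuous/(realization_neq0 (fR x)).
apply: (@drawing_bound R G m F (fun v => scale_max (f (p v)))
  (fun e s => scale_max (f (gamma e s)))) => //.
- by move=> v v' /scf_inj/p_inj.
- move=> e; have in_cont : {in [set gamma e x | x in `[0, 1]],
      continuous (fun x => scale_max (f x))} by move=> x _; apply: scf_cont.
  have h := @within_continuous_comp _ _ _ _ _ _ in_cont (@gamma_cont e).
  exact: h.
- by move=> e; have [-> ->] := gamma_ends e.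
- by move=> e s v s01 /scf_inj; apply: gamma_vertex.
- by move=> e e' s s' s01 s01' /scf_inj; apply: gamma_inj.
- by move=> v; apply: scale_max_realization.
by move=> e s _; apply: scale_max_realization.
Qed.

Lemma graph_degree (G : graph) (v : gvertex G) :
  (#|[set u | graph_adj v u]%SET| <= valence v)%N.
Proof.
have sub : [set u | graph_adj v u]%SET \subset
    ((@gtgt G) @: [set e | gsrc e == v] :|: (@gsrc G) @: [set e | gtgt e == v])%SET.
  apply/fintype.subsetP=> u; rewrite !inE => /exists_inP[e _].
  by case/orP=> /andP[/eqP e1 /eqP e2]; apply/orP; [left|right];
     apply/imsetP; exists e; rewrite ?inE ?e1 ?e2.
apply: leq_trans (subset_leq_card sub) (leq_trans (leq_card_setU _ _) _).
by rewrite leq_add ?leq_imset_card.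
Qed.

Lemma card_edge_boundary (G : graph) (A Y : {set gvertex G}) d :
    (forall v : gvertex G, (valence v <= d)%N) ->
    (forall a b, a \in A -> b \notin A -> graph_adj a b -> (a \in Y) || (b \in Y)) ->
  (#|edge_boundary A| <= d * #|Y|)%N.
Proof.
move=> val_le cover.
have sub : edge_boundary A \subset (\bigcup_(v in Y)
    ([set e | gsrc e == v] :|: [set e | gtgt e == v]))%SET.
  apply/fintype.subsetP=> e; rewrite inE => cut.
  have : (gsrc e \in Y) || (gtgt e \in Y).
    have adj_e b :
        graph_adj (if b then gsrc e else gtgt e) (if b then gtgt e else gsrc e).
      by apply/exists_inP; exists e; case: b; rewrite // !eqxx ?orbT.
    have [sA|sA] := boolP (gsrc e \in A); rewrite ?sA ?(negPf sA) /= in cut.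
      apply: (cover _ _ sA _ (adj_e true)); by case: (gtgt e \in A) cut.
    rewrite orbC; apply: (cover _ _ _ sA (adj_e false)); by case: (gtgt e \in A) cut.
  by case/orP=> vY; apply/finset.bigcupP; [exists (gsrc e)|exists (gtgt e)];
     rewrite // !inE eqxx ?orbT.
apply: leq_trans (subset_leq_card sub) (leq_trans (card_bigcup_le _ _) _).
rewrite mulnC -sum_nat_const; apply: leq_sum => v _.
exact: leq_trans (leq_card_setU _ _) (val_le v).
Qed.

(** Every boundary edge has an end in [Y], so the boundary of [A] has at most [d * #|Y|] edges; the
    Cheeger bound is applied to the smaller of [A] and its complement, which have the same
    boundary. *)
Lemma cheeger_vertex_expander (G : graph) d (h : R) :
    0 < h -> (h%:E <= cheeger R G)%E ->
    (forall v : gvertex G, (valence v <= d)%N) ->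
  vertex_expander (@graph_adj G) (Num.truncn (d%:R / h)).+1.
Proof.
move=> h0 hle val_le A Y cover.
set K := (Num.truncn _).+1.
have ltK : d%:R < K%:R * h by rewrite -ltr_pdivrMr // truncnS_gt.
have small (B : {set gvertex G}) : (2 * #|B| <= nb_vertices G)%N ->
    (#|edge_boundary B| <= d * #|Y|)%N -> (#|B| <= K * #|Y|)%N.
  move=> B2 bdB; have [->//|B0] := posnP #|B|.
  have : (h%:E <= (#|edge_boundary B|%:R / #|B|%:R : R)%:E)%E.
    apply: le_trans hle _; rewrite /cheeger.
    by apply: bigmin_le_cond; rewrite B0.
  rewrite lee_fin ler_pdivlMr ?ltr0n // => le1.
  have le2 : h * #|B|%:R <= h * (K * #|Y|)%:R.
    apply: le_trans le1 _; apply: (@le_trans _ _ (d * #|Y|)%:R).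
      by rewrite ler_nat.
    by rewrite !natrM mulrA ler_wpM2r // mulrC ltW.
  by rewrite ler_pM2l // ler_nat in le2.
have [le|lt] := leqP (2 * #|A|)%N (nb_vertices G).
  by left; apply: small => //; apply: card_edge_boundary.
right; apply: small.
  by have := cardsC A; rewrite /nb_vertices in lt *; lia.
have -> : edge_boundary (~: A)%SET = edge_boundary A.
  by apply/finset.setP=> e; rewrite !inE; case: (_ \in A); case: (_ \in A).
exact: card_edge_boundary.
Qed.

Lemma limn_einf_gt0 (u : nat -> \bar R) : (0 < limn_einf u)%E ->
  exists n (h : R), 0 < h /\ forall k, (n <= k)%N -> (h%:E <= u k)%E.
Proof.
rewrite limn_einf_lim => lim0.
have cvg_u := ereal_nondecreasing_cvgn (nondecreasing_einfs u).
move: lim0; rewrite (cvg_lim _ cvg_u) // => /ereal_sup_gt[_ [n _ <-] pos].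
have lb k : (n <= k)%N -> (einfs u n <= u k)%E.
  by move=> nk; apply: ereal_inf_lbound; exists k.
case: (einfs u n) pos lb => [h| |] pos lb.
- by exists n, h; split=> //; rewrite -lte_fin.
(* The infimum of the tail is [+oo], so every positive real serves as a bound. *)
- by exists n, 1; split=> // k /lb; rewrite leye_eq => /eqP ->; rewrite leey.
by [].
Qed.
End Genus.

Unset Implicit Arguments.

(* The bound is asserted for all but finitely many i: an expander may start
   with arbitrary graphs, e.g. planar ones, for which it fails. *)
Theorem corollary1p6 (R : realType) (G : nat -> graph) (hG : expander R G) :
  exists c : R, 0 < c /\
    \forall i \near \oo, ((c * (nb_vertices (G i))%:R)%:E <= genus R (G i))%E.
Proof.
have [[d val_le] cvgN /limn_einf_gt0[n [h [h0 hle]]]] := hG.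
pose K := (Num.truncn (d%:R / h)).+1; pose C := (region_constant d K).+1.
have C0 : 0 < C%:R :> R by rewrite ltr0n.
(* From N <= C (g + 1) one gets g >= N / C - 1, which is at least N / (2 C) as soon as N >= 2 C. *)
exists (2 * C%:R)^-1; split; first by rewrite invr_gt0 mulr_gt0.
have bigN : \forall i \near \oo, (2 * C <= nb_vertices (G i))%N.
  by have /cvgnyPge/(_ (2 * C)%N) := cvgN.
near=> i.
have Ni : (2 * C <= nb_vertices (G i))%N by near: i.
have ni : (n <= i)%N by near: i; exists n.
apply: le_ereal_inf_tmp => _ [g [S [_ orS embS]] <-].
have deg (v : gvertex (G i)) : (#|[set u | graph_adj v u]%SET| <= d)%N.
  exact: leq_trans (graph_degree v) (val_le i v).
have exp := cheeger_vertex_expander h0 (hle i ni) (val_le i).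
have N0 : (0 < nb_vertices (G i))%N by apply: leq_trans Ni; rewrite muln_gt0.
have bound := embedding_bound orS embS deg exp (ltn0Sn _) N0.
rewrite lee_fin mulrC ler_pdivrMr ?mulr_gt0 //.
have le : (nb_vertices (G i) <= g * (2 * C))%N.
  have : (nb_vertices (G i) <= C * g.+1)%N.
    by apply: leq_trans bound _; rewrite leq_mul2r leqnSn orbT.
  by rewrite mulnS; move: Ni; lia.
by rewrite -natrM -natrM ler_nat.
Unshelve. all: by end_near. Qed.
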